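(* Let $X$ be a Helly graph with finite combinatorial dimension, and let $P_X$ denote the poset of all round cliques of $X$, ordered by inclusion. Then the injective hull $E(X)$ has a canonical simplicial structure isometric to the $\ell^\infty$ orthoscheme realization of the poset $P_X$ with edge lengths $\frac12$.
   Context: A graph is identified with its vertex set, with graph metric $d$ (edges of length $1$); $B(x,r)=\{y: d(x,y)\le r\}$. A connected graph is Helly if every family of pairwise intersecting combinatorial balls has non-empty intersection. A clique is the (non-empty) vertex set of a complete subgraph; a clique is round if it is an intersection of balls of $X$. The injective hull: $E(X)=\{f:X\to\mathbb{R} \mid f(x)+f(y)\ge d(x,y)\ \forall x,y,\ \text{and}\ f(x)=\sup_{y}(d(x,y)-f(y))\ \forall x\}$ with the sup metric; $X\subset E(X)$ via $x\mapsto d(x,\cdot)$. The combinatorial dimension of $X$ is the dimension of $E(X)$. The $\ell^\infty$ orthoscheme realization of a poset $P$ with edge lengths $\ell$ is the simplicial complex with vertex set $P$ whose simplices are the chains $v_0<v_1<\dots<v_k$ of $P$, each such simplex being metrized as the standard $\ell^\infty$ orthosimplex in $\mathbb{R}^k$ with vertices $(0,\dots,0),(\ell,0,\dots,0),\dots,(\ell,\dots,\ell)$, $v_i$ corresponding to the vertex with exactly $i$ coordinates equal to $\ell$. *)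

(* Defs.v *)
From HB Require Import structures.
From mathcomp Require Import all_boot all_order all_algebra.
From mathcomp Require Import all_classical all_reals all_analysis.
From mathcomp Require Import lra.

Set Implicit Arguments.
Unset Strict Implicit.
Unset Printing Implicit Defensive.

Import Order.TTheory GRing.Theory Num.Theory.
Import numFieldNormedType.Exports.

Local Open Scope classical_set_scope.
Local Open Scope ring_scope.

Fixpoint walk (V : Type) (adj : V -> V -> Prop) (n : nat) (x y : V) : Prop :=
  if n is m.+1 then exists2 z, adj x z & walk adj m z y else x = y.

Record connected_graph := ConnectedGraph {
  vertex :> Type;
  adj : vertex -> vertex -> Prop;
  adj_sym : forall x y, adj x y -> adj y x;
  adj_irrefl : forall x, ~ adj x x;
  adj_connected : forall x y, exists n, walk adj n x y }.

Lemma walk_cat (V : Type) (e : V -> V -> Prop) m n x y z :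
  walk e m x y -> walk e n y z -> walk e (m + n) x z.
Proof.
elim: m x => [|m IH] x /=; first by move=> ->.
by move=> [w xw wy] yz; exists w => //; exact: IH wy yz.
Qed.

Lemma walk_rev (V : Type) (e : V -> V -> Prop) (eC : forall x y, e x y -> e y x)
  n x y : walk e n x y -> walk e n y x.
Proof.
elim: n x => [|n IH] x /=; first by move=> ->.
move=> [w xw /IH yw]; have wx : walk e 1 w x by exists x => //; exact: eC.
by have := walk_cat yw wx; rewrite addn1.
Qed.

Section graph_metric.
Variable X : connected_graph.
Implicit Types x y z : X.

Lemma ex_walk x y : exists n, `[< walk (@adj X) n x y >].
Proof. by have [n xy] := adj_connected x y; exists n; apply/asboolP. Qed.

Definition gdist x y : nat := ex_minn (ex_walk x y).

Lemma gdistxx x : gdist x x = 0%N.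
Proof.
rewrite /gdist; case: ex_minnP => n _ /(_ 0%N).
by rewrite leqn0 => /(_ _)/eqP; apply; apply/asboolP.
Qed.

Lemma gdist_eq0 x y : gdist x y = 0%N -> x = y.
Proof. by rewrite /gdist; case: ex_minnP => n /asboolP + _ n0; rewrite n0. Qed.

Lemma gdistC x y : gdist x y = gdist y x.
Proof.
suff le a b : (gdist a b <= gdist b a)%N by apply/eqP; rewrite eqn_leq !le.
rewrite /gdist; case: ex_minnP => n _ nmin; case: ex_minnP => m /asboolP ba _.
by apply: nmin; apply/asboolP; apply: walk_rev ba; exact: adj_sym.
Qed.

Lemma gdist_triangle y x z : (gdist x z <= gdist x y + gdist y z)%N.
Proof.
rewrite /gdist; case: ex_minnP => n _ nmin.
case: ex_minnP => p /asboolP xy _; case: ex_minnP => q /asboolP yz _.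
by apply: nmin; apply/asboolP; exact: walk_cat xy yz.
Qed.

Definition gball x (r : nat) : set X := [set y | (gdist x y <= r)%N].

(* The empty family is allowed, so that a Helly graph has a vertex. *)
Definition helly : Prop :=
  forall F : set (X * nat),
    (forall p q, F p -> F q -> gball p.1 p.2 `&` gball q.1 q.2 !=set0) ->
    \bigcap_(p in F) gball p.1 p.2 !=set0.

Definition is_clique (C : set X) : Prop :=
  C !=set0 /\ forall x y, C x -> C y -> x <> y -> adj x y.

Definition is_round (C : set X) : Prop :=
  exists F : set (X * nat), C = \bigcap_(p in F) gball p.1 p.2.

End graph_metric.

(* The vertex set with [gdist] as an [R]-valued metric. *)
Definition graph_space (R : realType) (X : connected_graph) : Type := X.

Section graph_space.
Variables (R : realType) (X : connected_graph).

HB.instance Definition _ := gen_eqMixin (graph_space R X).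
HB.instance Definition _ := gen_choiceMixin (graph_space R X).

Let d (x y : graph_space R X) : R := (@gdist X x y)%:R.

Let dxx x : d x x = 0. Proof. by rewrite /d gdistxx. Qed.

Let d_eq0 x y : d x y = 0 -> x = y.
Proof. by move/eqP; rewrite /d pnatr_eq0 => /eqP; exact: gdist_eq0. Qed.

Let dC x y : d x y = d y x. Proof. by rewrite /d gdistC. Qed.

Let d_triangle y x z : d x z <= d x y + d y z.
Proof. by rewrite /d -natrD ler_nat gdist_triangle. Qed.

HB.instance Definition _ := isMetric.Build R (graph_space R X)
  dxx d_eq0 dC d_triangle.

End graph_space.

(* By [hull_ge], the set in [hull_sup] is bounded above by [hull_fun x]. *)
Record injective_hull (R : realType) (M : metricType R) := InjectiveHull {
  hull_fun :> M -> R;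
  hull_ge : forall x y, mdist x y <= hull_fun x + hull_fun y;
  hull_sup : forall x, hull_fun x = sup (range (fun y => mdist x y - hull_fun y)) }.

Section injective_hull.
Variables (R : realType) (M : metricType R).
Implicit Types (x y : M) (f g h : injective_hull M).

HB.instance Definition _ := gen_eqMixin (injective_hull M).
HB.instance Definition _ := gen_choiceMixin (injective_hull M).

Lemma hull_eq f g : f =1 g -> f = g.
Proof.
case: f g => [f f1 f2] [g g1 g2] /= /funext fg.
by case: g / fg g1 g2 => g1 g2; congr InjectiveHull; exact: Prop_irrelevance.
Qed.

Lemma hull_lipschitz f x y : f x <= mdist x y + f y.
Proof.
rewrite (hull_sup f x); apply: ge_sup; first by exists (mdist x x - f x), x.
move=> _ [z _ <-]; rewrite lerBlDr -addrA (le_trans (metric_triangle x y z))//.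
by rewrite lerD2l hull_ge.
Qed.

Definition hull_dist f g : R := sup (range (fun x => `|f x - g x|)).

Lemma hull_dist_ubound f g : has_ubound (range (fun x => `|f x - g x|)).
Proof.
have [[x0 _]|/set0P/negP] := pselect ([set: M] !=set0); last first.
  by rewrite negbK => /eqP M0; exists 0 => _ [x _ <-]; have := I; rewrite -[True]/(setT x) M0.
exists (f x0 + g x0) => _ [x _ <-]; rewrite ler_norml; apply/andP; split.
  rewrite lerBrDl -lerBrDr opprK.
  have := hull_lipschitz g x x0; have := hull_ge f x x0; lra.
have := hull_lipschitz f x x0; have := hull_ge g x x0; lra.
Qed.

Lemma hull_dist_ge f g x : `|f x - g x| <= hull_dist f g.
Proof. by apply: (ub_le_sup (hull_dist_ubound f g)); exists x. Qed.

Lemma hull_dist_le f g (r : R) : 0 <= r ->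
  (forall x, `|f x - g x| <= r) -> hull_dist f g <= r.
Proof.
move=> r0 fgr; rewrite /hull_dist.
have [S0|/set0P/negP] := pselect (range (fun x => `|f x - g x|) !=set0).
  by apply: ge_sup => // _ [x _ <-].
by rewrite negbK => /eqP ->; rewrite sup0.
Qed.

Lemma hull_dist_ge0 f g : 0 <= hull_dist f g.
Proof.
rewrite /hull_dist.
have [[_ [x _ _]]|/set0P/negP] := pselect (range (fun x => `|f x - g x|) !=set0).
  exact: le_trans (hull_dist_ge f g x).
by rewrite negbK => /eqP ->; rewrite sup0.
Qed.

Let hull_distxx f : hull_dist f f = 0.
Proof.
apply/eqP; rewrite eq_le hull_dist_ge0 andbT.
by apply: hull_dist_le => // x; rewrite subrr normr0.
Qed.

Let hull_dist_eq0 f g : hull_dist f g = 0 -> f = g.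
Proof.
move=> fg0; apply: hull_eq => x; apply/eqP; rewrite -subr_eq0 -normr_le0 -fg0.
exact: hull_dist_ge.
Qed.

Let hull_distC f g : hull_dist f g = hull_dist g f.
Proof.
by rewrite /hull_dist; under eq_fun => x do rewrite distrC.
Qed.

Let hull_dist_triangle g f h : hull_dist f h <= hull_dist f g + hull_dist g h.
Proof.
apply: hull_dist_le => [|x]; first by rewrite addr_ge0// hull_dist_ge0.
rewrite (le_trans (ler_distD (g x) _ _))//.
by rewrite lerD// hull_dist_ge.
Qed.

HB.instance Definition _ := isMetric.Build R (injective_hull M)
  hull_distxx hull_dist_eq0 hull_distC hull_dist_triangle.

Lemma hull_point_ge (x y z : M) : mdist y z <= mdist x y + mdist x z.
Proof. by rewrite (metric_sym x y) metric_triangle. Qed.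

Lemma hull_point_sup (x y : M) :
  mdist x y = sup (range (fun z => mdist y z - mdist x z)).
Proof.
apply/eqP; rewrite eq_le; apply/andP; split.
  have ub : has_ubound (range (fun z => mdist y z - mdist x z)).
    by exists (mdist x y) => _ [z _ <-]; rewrite lerBlDr hull_point_ge.
  by apply: (ub_le_sup ub); exists x => //; rewrite mdistxx subr0 metric_sym.
apply: ge_sup; first by exists (mdist y x - mdist x x), x.
by move=> _ [z _ <-]; rewrite lerBlDr hull_point_ge.
Qed.

Definition hull_point (x : M) : injective_hull M :=
  InjectiveHull (hull_point_ge x) (hull_point_sup x).

End injective_hull.

(* Lebesgue covering dimension: the order condition says that every point lies
   in at most [n.+1] members of the refinement. *)
Definition covering_dim_le (T : topologicalType) (n : nat) : Prop :=
  forall U : set (set T), (forall A, U A -> open A) ->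
    \bigcup_(A in U) A = setT ->
  exists V : set (set T),
    [/\ forall B, V B -> open B,
        \bigcup_(B in V) B = setT,
        forall B, V B -> exists2 A, U A & B `<=` A &
        forall x, ([set B | V B /\ B x] #<= `I_n.+1)%card].

Definition finite_combinatorial_dim (R : realType) (M : metricType R) : Prop :=
  exists n, covering_dim_le (injective_hull M) n.

Record round_clique (X : connected_graph) := RoundClique {
  rc_set :> set X;
  rc_clique : is_clique rc_set;
  rc_round : is_round rc_set }.

Fact round_clique_display : Order.disp_t. Proof. by []. Qed.

Section round_clique.
Variable X : connected_graph.
Implicit Types A B C : round_clique X.

HB.instance Definition _ := gen_eqMixin (round_clique X).
HB.instance Definition _ := gen_choiceMixin (round_clique X).

Lemma round_clique_eq A B : A = B :> set X -> A = B.
Proof.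
case: A B => [A A1 A2] [B B1 B2] /= AB; case: B / AB B1 B2 => B1 B2.
by congr RoundClique; exact: Prop_irrelevance.
Qed.

Definition rc_le A B : bool := `[< A `<=` B >].

Let rc_le_refl : reflexive rc_le. Proof. by move=> A; exact/asboolP. Qed.

Let rc_le_anti : antisymmetric rc_le.
Proof.
move=> A B /andP[/asboolP AB /asboolP BA].
by apply: round_clique_eq; apply/seteqP.
Qed.

Let rc_le_trans : transitive rc_le.
Proof.
by move=> B A C /asboolP AB /asboolP BC; apply/asboolP; exact: subset_trans BC.
Qed.

HB.instance Definition _ := Order.Le_isPOrder.Build round_clique_display
  (round_clique X) rc_le_refl rc_le_anti rc_le_trans.

Lemma set1_clique (x : X) : is_clique [set x].
Proof. by split; [exists x|move=> y z -> ->]. Qed.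

Lemma set1_round (x : X) : is_round [set x].
Proof.
exists [set (x, 0%N)]; rewrite bigcap_set1; apply/seteqP; split => y /=.
  by move=> ->; rewrite /gball/= gdistxx.
by rewrite /gball/= leqn0 => /eqP/gdist_eq0.
Qed.

Definition rc_set1 (x : X) : round_clique X :=
  RoundClique (set1_clique x) (set1_round x).

End round_clique.

(* Points of the simplicial complex of chains, in barycentric coordinates. *)
Record realization (R : realType) (d : Order.disp_t) (P : porderType d) :=
  Realization {
    bary :> P -> R;
    bary_ge0 : forall p, 0 <= bary p;
    bary_finite : finite_set [set p | bary p != 0];
    bary_chain : forall p q, bary p != 0 -> bary q != 0 -> (p >=< q)%O;
    bary_sum : \sum_(p \in [set: P]) bary p = 1 }.

Section realization.
Variables (R : realType) (d : Order.disp_t) (P : porderType d).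
Implicit Types (p q : P) (a b : realization R P).

Let ind p q : R := (q == p)%:R.

Let ind_supp p : [set q | ind p q != 0] = [set p].
Proof.
by apply/seteqP; split => q /=; rewrite /ind pnatr_eq0 eqb0 negbK => /eqP.
Qed.

Let ind_ge0 p q : 0 <= ind p q. Proof. exact: ler0n. Qed.

Let ind_finite p : finite_set [set q | ind p q != 0].
Proof. by rewrite ind_supp. Qed.

Let ind_chain p q r : ind p q != 0 -> ind p r != 0 -> (q >=< r)%O.
Proof.
by rewrite /ind !pnatr_eq0 !eqb0 !negbK => /eqP -> /eqP ->; rewrite comparablexx.
Qed.

Let ind_sum p : \sum_(q \in [set: P]) ind p q = 1.
Proof.
rewrite -(@fsbig_widen _ _ _ _ [set p]) //.
  by rewrite fsbig_set1 /ind eqxx.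
by move=> q [_ /= /eqP/negPf qp]; rewrite /preimage/= /ind qp.
Qed.

Definition realization_vertex p : realization R P :=
  Realization (ind_ge0 p) (ind_finite p) (@ind_chain p) (ind_sum p).

(* (l, ..., l, 0, ..., 0) with i coordinates equal to l *)
Definition orthovertex (l : R) (k : nat) (i : 'I_k.+1) : 'rV[R]_k :=
  \row_(j < k) (if (j < i)%N then l else 0).

Definition orthopoint (l : R) (k : nat) (v : 'I_k.+1 -> P) a : 'rV[R]_k :=
  \sum_(i < k.+1) a (v i) *: orthovertex l i.

(* [simplex_dist l a b r]: some chain v_0 < ... < v_k spans a simplex that
   contains a and b, and r is their distance in the corresponding orthosimplex;
   the norm of a row vector is its sup norm. *)
Definition simplex_dist (l : R) a b (r : R) : Prop :=
  exists (k : nat) (v : 'I_k.+1 -> P),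
    [/\ forall i j : 'I_k.+1, (i < j)%N -> (v i < v j)%O,
        [set p | a p != 0] `<=` range v,
        [set p | b p != 0] `<=` range v &
        r = `|orthopoint l v a - orthopoint l v b|].

(* Lengths of the strings a = c_0, c_1, ..., c_n = b in which consecutive points
   lie in a common simplex. *)
Definition string_lengths (l : R) a b : set R :=
  [set s | exists (n : nat) (c : nat -> realization R P) (r : nat -> R),
    [/\ c 0%N = a, c n = b,
        forall i, (i < n)%N -> simplex_dist l (c i) (c i.+1) (r i) &
        s = \sum_(i < n) r i]].

(* The quotient (intrinsic) pseudometric on the metric simplicial complex; it is
   +oo between different connected components. *)
Definition orthoscheme_dist (l : R) a b : \bar R :=
  ereal_inf [set s%:E | s in string_lengths l a b].

End realization.

(* Main.v *)
Require Import Defs.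
From mathcomp Require Import all_boot all_order all_algebra.
From mathcomp Require Import all_fingroup.
From mathcomp Require Import all_classical all_reals all_analysis.
From mathcomp Require Import ring lra zify.

(** To a round clique [p] associate the function
    [cdist p x = (min_{v in p} d(x,v) + max_{v in p} d(x,v)) / 2]. By the Helly
    property these are exactly the elements of the hull with values in Z/2, and
    averages of [cdist] over a chain of cliques stay in the hull; this is [phi].
    The variation of [p |-> cdist p x] along a chain is at most 1/2, and an [x]
    in [v_{j+1}] but not in [v_j] reads off the [j]-th orthoscheme coordinate,
    so [phi] is an isometry on each simplex.

    Conversely, if the distances to Z of the values of [f] in the hull form a
    finite set s_0 < s_1 < ..., then [f] is the average of its roundings at the
    thresholds s_i, which are half-integral, i.e. of the form [cdist p_i] with
    [p_i] decreasing. Finiteness is where the dimension enters: a nondecreasing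
    Lipschitz function [g] with [g (n - s) = n - g s] for all integers [n] acts
    on the hull by composition, and if [f] had n + 1 values with distinct
    distances to Z, other than 0 and 1/2, bumps of such [g] at these values would give a map of an
    (n+1)-cube into the hull keeping opposite faces apart. Lebesgue's covering
    theorem, through Kuhn's cubical Sperner lemma, excludes this.

    Finally, rounding shows that functions of the hull close to [phi a] share a
    simplex with [a]. Hence [phi] is injective, and a geodesic of the hull (a
    segment retracted onto the hull) subdivides into a string of simplices of the
    same length. Uniqueness holds because [f x] is the distance from [f] to [x]. *)

Set Implicit Arguments.
Unset Strict Implicit.
Unset Printing Implicit Defensive.

Import Order.TTheory GRing.Theory Num.Theory.
Import numFieldNormedType.Exports.

Local Open Scope classical_set_scope.
Local Open Scope ring_scope.

(** * Kuhn's cubical Sperner lemma *)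

Section kuhn.
Variables (N m' : nat).
Local Notation m := m'.+1.
Variable lab : ('I_N -> nat) -> nat.
Hypothesis lab_le : forall p, (forall i, p i <= m)%N -> (lab p <= N)%N.
Hypothesis lab_bot : forall p i, (forall i, p i <= m)%N -> p i = 0%N -> (lab p <= i)%N.
Hypothesis lab_top : forall p i, (forall i, p i <= m)%N -> p i = m -> lab p <> i.

Implicit Types (b : {ffun 'I_N -> 'I_m}) (s t : 'S_N) (q : 'I_N -> nat).

Definition base b : 'I_N -> nat := fun i => b i.

(* [s i] is the step of the monotone path at which coordinate [i] is incremented. *)
Definition kuhn_point q s (j : nat) : 'I_N -> nat := fun i => (q i + (s i < j)%N)%N.

(** The determinant is 1 when the labels of [v 0], ..., [v k] are exactly 0, ..., [k], and 0
    otherwise: a repeated label gives equal rows, a label above [k] a zero row. Determinants over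
    F_2 thus count fully labelled simplices modulo 2. *)
Definition label_mx k (v : nat -> 'I_N -> nat) : 'M['F_2]_k.+1 :=
  \matrix_(r, c) (lab (v r) == c :> nat)%:R.

(** Kuhn simplices of the face of the cube where the coordinates from [k] on vanish: the base is 0
    there, and the steps before time [k] use only the first [k] coordinates. *)
Definition flat_base k b := [forall i : 'I_N, (k <= i)%N ==> (b i == 0%N :> nat)].
Definition flat_perm k s := [forall i : 'I_N, (k <= i)%N ==> (s i == i)].

Definition kuhn_count k : 'F_2 :=
  \sum_(b | flat_base k b) \sum_(s | flat_perm k s)
    \det (label_mx k (kuhn_point (base b) s)).

Lemma addF2 (x : 'F_2) : x + x = 0.
Proof. by apply/eqP; case: x => [[|[|]]]. Qed.

Lemma oppF2 (x : 'F_2) : - x = x.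
Proof. by apply/eqP; case: x => [[|[|]]]. Qed.

Lemma signF2 i (x : 'F_2) : (-1) ^+ i * x = x.
Proof. by rewrite oppF2 expr1n mul1r. Qed.

(** The permutations [s] and [s * tperm x y] have opposite parities, so even and odd permutations
    give the same sum, and the two sums cancel over F_2. *)
Lemma sum_tpermF2 (P : pred 'S_N) (G : 'S_N -> 'F_2) (x y : 'I_N) : x != y ->
  (forall s, P (s * tperm x y)%g = P s) -> (forall s, G (s * tperm x y)%g = G s) ->
  \sum_(s | P s) G s = 0.
Proof.
move=> xy Pt Gt; rewrite (bigID (@odd_perm _)) /=.
rewrite (reindex_inj (mulIg (tperm x y))) /=.
rewrite (eq_big (fun s => P s && ~~ s) G) ?addF2// => s.
by rewrite Pt odd_permM odd_tperm xy addbT.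
Qed.

Lemma det_col0 k (A : 'M['F_2]_k) c : (forall r, A r c = 0) -> \det A = 0.
Proof.
by move=> A0; rewrite (expand_det_col A c) big1// => r _; rewrite A0 mul0r.
Qed.

(* The rows of the label matrix sum to 1, so that replacing the last column by
   ones does not change the determinant. *)
Lemma det_label_mx k v : (forall r, (r <= k.+1)%N -> (lab (v r) <= k.+1)%N) ->
  \det (label_mx k.+1 v) =
  \sum_(r < k.+2) \det (label_mx k (fun i => v (bump r i))).
Proof.
move=> le; set A := label_mx _ v.
have cof r : cofactor A r ord_max = \det (label_mx k (fun i => v (bump r i))).
  rewrite /cofactor signF2; congr (\det _); apply/matrixP => i j; rewrite !mxE.
  by rewrite lift_max.
under eq_bigr do rewrite -cof.
have one r : \sum_c A r c = 1.
  have lt : (lab (v r) < k.+2)%N by rewrite ltnS le// -ltnS.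
  rewrite (bigD1 (Ordinal lt))//= mxE eqxx big1 ?addr0// => c cn.
  by rewrite mxE; case: eqP => // e; case/eqP: cn; apply: val_inj; rewrite /= e.
transitivity (\sum_r \sum_c (\adj A ord_max r * A r c)); last first.
  by apply: eq_bigr => r _; rewrite -big_distrr /= one mulr1 mxE.
rewrite exchange_big /=.
have adj c : \sum_r (\adj A ord_max r * A r c) = (\det A)%:M ord_max c.
  by rewrite -mul_adj_mx [RHS]mxE.
under eq_bigr do rewrite adj.
rewrite (bigD1 ord_max)//= mxE eqxx mulr1n big1 ?addr0// => c cn.
by rewrite mxE eq_sym (negPf cn).
Qed.

Lemma kuhn_point_le b s j i : (kuhn_point (base b) s j i <= m)%N.
Proof.
rewrite /kuhn_point ?/base; have := ltn_ord (b i).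
by case: (s i < j)%N; lia.
Qed.

Lemma flat_permX k s t : flat_perm k t -> flat_perm k (s * t)%g = flat_perm k s.
Proof.
move=> /forallP kt; have kt' (i : 'I_N) : (k <= i)%N -> t i = i.
  by move=> ki; apply/eqP; apply: (implyP (kt i)).
apply: eq_forallb => i.
have [ki|] //= := leqP k i.
by rewrite permM -{2}(kt' i ki) (inj_eq perm_inj).
Qed.

Lemma flat_perm_lt k s (i : 'I_N) : flat_perm k s -> (s i < k)%N = (i < k)%N.
Proof.
move=> /forallP ks; have ks' (j : 'I_N) : (k <= j)%N -> s j = j.
  by move=> ki; apply/eqP; apply: (implyP (ks j)).
apply/idP/idP; last first.
  apply: contraTT; rewrite -!leqNgt => ki.
  have /perm_inj sii : s (s i) = s i by rewrite ks'.
  by rewrite -sii.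
apply: contraTT; rewrite -!leqNgt => ki; by rewrite ks'.
Qed.

(** When [k < N], coordinate [k] is still 0 at these points, and [lab_bot] applies to it. *)
Lemma flat_lab_le k b s j : (k <= N)%N -> (j <= k)%N -> flat_base k b -> flat_perm k s ->
  (lab (kuhn_point (base b) s j) <= k)%N.
Proof.
move=> kN jk /forallP kb /[dup] ks /forallP ks'.
move: kN; rewrite leq_eqVlt => /orP[/eqP ->|kN].
  by apply: lab_le => i; apply: kuhn_point_le.
apply: (@lab_bot _ (Ordinal kN)) => [i|]; first exact: kuhn_point_le.
rewrite /kuhn_point ?/base (eqP (implyP (kb _) _))//= add0n.
by rewrite (eqP (implyP (ks' _) _))//= ltnNge jk.
Qed.

Lemma kuhn_count0 : kuhn_count 0 = 1.
Proof.
rewrite /kuhn_count (big_pred1 [ffun=> ord0]); last first.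
  move=> b; apply/forallP/eqP => [b0|-> i]; last by rewrite ffunE.
  by apply/ffunP => i; rewrite ffunE; apply: val_inj; apply/eqP; exact: (implyP (b0 i)).
rewrite (big_pred1 1%g); last first.
  move=> s; apply/forallP/eqP => [s0|-> i]; last by rewrite perm1 eqxx.
  by apply/permP => i; rewrite perm1; apply/eqP; exact: (implyP (s0 i)).
rewrite det_mx11 mxE /= -leqn0 (@flat_lab_le 0)//.
  by apply/forallP => i; rewrite ffunE.
by apply/forallP => i; rewrite perm1 eqxx.
Qed.

Section step.
Variables (k : nat) (kN : (k < N)%N).
Let ok := Ordinal kN.

Definition rotate_fun (i : 'I_N) : 'I_N :=
  if i == 0%N :> nat then ok else if (i <= k)%N then Ordinal (leq_ltn_trans (leq_pred i) (ltn_ord i)) else i.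

Lemma rotate_inj : injective rotate_fun.
Proof.
move=> i j /(congr1 val) ij; apply: val_inj; move: ij; rewrite /rotate_fun.
by do 2!case: ifP => /= ?; do ?case: ifP => /= ?; lia.
Qed.

Definition rotate_perm : 'S_N := perm rotate_inj.

Lemma flat_rotate : flat_perm k.+1 rotate_perm.
Proof.
apply/forallP => i; apply/implyP => ki; rewrite permE -val_eqE /rotate_fun.
by have -> : (i == 0%N :> nat) = false; [lia|rewrite leqNgt ki /=].
Qed.

Definition incr (x : 'I_N) q : 'I_N -> nat := fun i => (q i + (i == x))%N.

(** Dropping the first vertex starts the path after its first step. The coordinate moved by that
    step goes into the base point, and the rotation postpones its own step to time [k], past the end
    of a path with [k] steps. *)
Lemma face_bot b s : flat_perm k.+1 s ->
  label_mx k (fun i => kuhn_point (base b) s (bump 0 i)) =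
  label_mx k (kuhn_point (incr ((s * rotate_perm)^-1%g ok) (base b)) (s * rotate_perm)%g).
Proof.
move=> ks; apply/matrixP => r c; rewrite !mxE; congr (_ == _)%:R; congr lab.
apply/funext => i; rewrite /kuhn_point ?/base /incr -addnA; congr addn.
have -> : (i == (s * rotate_perm)^-1%g ok) = (s i == 0%N :> nat).
  rewrite -(inj_eq (@perm_inj _ (s * rotate_perm)%g)) permKV permM.
  have -> : ok = rotate_perm (Ordinal (leq_ltn_trans (leq0n k) kN)) by rewrite permE /rotate_fun.
  by rewrite (inj_eq perm_inj).
rewrite permM permE /rotate_fun /bump /=.
have := ltn_ord r; case: ifP => /= ?; first by lia.
by case: ifP => /= ?; lia.
Qed.

(** An interior face belongs to two simplices, which differ by exchanging steps [r.-1] and [r]. *)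
Lemma face_mid b (r : nat) : (0 < r)%N -> (r <= k)%N ->
  \sum_(s | flat_perm k.+1 s) \det (label_mx k (fun i => kuhn_point (base b) s (bump r i))) = 0.
Proof.
move=> r0 rk; have rN : (r < N)%N by lia.
have r1N : (r.-1 < N)%N by lia.
apply: (@sum_tpermF2 _ _ (Ordinal r1N) (Ordinal rN)).
- by rewrite -val_eqE /=; lia.
- move=> s; apply: flat_permX; apply/forallP => i; apply/implyP => ki.
  by rewrite tpermD// -val_eqE /=; lia.
move=> s; congr (\det _); apply/matrixP => i c; rewrite !mxE; congr (_ == _)%:R.
congr lab; apply/funext => x; rewrite /kuhn_point ?/base; congr (_ + nat_of_bool _)%N.
rewrite permM /bump; case: tpermP => [->|->|//] /=; lia.
Qed.

Lemma face_top b s :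
  label_mx k (fun i => kuhn_point (base b) s (bump k.+1 i)) = label_mx k (kuhn_point (base b) s).
Proof.
by apply/matrixP => i c; rewrite !mxE /bump [(k < i)%N]ltnNge -ltnS ltn_ord.
Qed.

(** Here [x] is the coordinate moved at time [k], so these simplices lie in hyperplanes orthogonal
    to it. Each layer translated by one unit is the next layer, and the sums cancel except at the
    ends: the layer at height [m] lacks the label [x], and the layer at height 0 remains. *)
Lemma kuhn_telescope s (x := (s^-1)%g ok) : flat_perm k.+1 s ->
  \sum_(b | flat_base k.+1 b) \det (label_mx k (kuhn_point (incr x (base b)) s)) +
  \sum_(b | flat_base k.+1 b) \det (label_mx k (kuhn_point (base b) s)) =
  \sum_(b | flat_base k.+1 b && (b x == 0%N :> nat)) \det (label_mx k (kuhn_point (base b) s)).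
Proof.
move=> ks; rewrite (bigID (fun b => b x == m' :> nat)) /= big1 ?add0r; last first.
  move=> b /andP[kb /eqP bx].
  have xk : (x < k.+1)%N by rewrite -(flat_perm_lt x ks) permKV.
  apply: (@det_col0 _ _ (Ordinal xk)) => r; rewrite mxE; case: eqP => //.
  move=> e; case: (@lab_top (kuhn_point (incr x (base b)) s r) x) => // [i|].
    rewrite /kuhn_point ?/base /incr; have [->|ix] := eqVneq i x.
      by rewrite permKV bx /=; have := ltn_ord r; lia.
    by rewrite addn0; apply: kuhn_point_le.
  by rewrite /kuhn_point ?/base /incr eqxx permKV bx /=; have := ltn_ord r; lia.
rewrite [in X in _ + X](bigID (fun b => b x == 0%N :> nat)) /=.
rewrite [X in _ + X]addrC addrA.
set S1 := (X in X + _ + _); set S2 := (X in _ + X + _).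
suff -> : S1 = S2 by rewrite addF2 add0r.
pose up b : {ffun 'I_N -> 'I_m} := [ffun i => if i == x then inord (b i).+1 else b i].
pose down b : {ffun 'I_N -> 'I_m} := [ffun i => if i == x then inord (b i).-1 else b i].
have xk : (x < k.+1)%N by rewrite -(flat_perm_lt x ks) permKV.
rewrite /S2 (reindex_onto up down) /=; last first.
  move=> b /andP[_ bx]; apply/ffunP => i; rewrite !ffunE; case: eqP => // ->.
  have bm := ltn_ord (b x).
  have e : (inord (b x).-1 : 'I_m) = (b x).-1 :> nat by rewrite inordK; lia.
  by apply: val_inj; rewrite /= e inordK; lia.
apply: eq_big => [b|b /andP[kb bx]].
  have bxm := ltn_ord (b x).
  have [bx|bx] /= := eqVneq (b x : nat) m'.
    rewrite andbF; apply/esym; apply/negP => /andP[/andP[_ H] /eqP/ffunP/(_ x)].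
    move=> /(congr1 val); rewrite !ffunE eqxx bx /=.
    move: H; rewrite !ffunE eqxx bx.
    (* [inord] sends a value out of range to 0, so [up b] violates the condition that coordinate [x]
       is nonzero. *)
    have -> : inord m'.+1 = inord 0 :> 'I_m by apply: val_inj; rewrite !val_insubd ltnn.
    by rewrite inordK.
  rewrite andbT.
  have updown : down (up b) == b.
    apply/eqP/ffunP => i; rewrite !ffunE; case: eqP => // ->.
    have e : (inord (b x).+1 : 'I_m) = (b x).+1 :> nat by rewrite inordK; lia.
    by apply: val_inj; rewrite /= e inordK.
  rewrite updown ffunE eqxx inordK; last by lia.
  rewrite !andbT; apply: eq_forallb => i; rewrite ffunE.
  by have [->|//] := eqVneq i x; rewrite leqNgt xk.
congr (\det _); apply/matrixP => r c; rewrite !mxE; congr (_ == _)%:R.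
congr lab; apply/funext => i; rewrite /kuhn_point ?/base /incr !ffunE.
case: eqP => [->|]; last by rewrite addn0.
rewrite inordK ?addn1//; have := ltn_ord (b x); lia.
Qed.

(** Each determinant expands over the faces of its simplex. Interior faces cancel; first and last
    faces telescope to the walls [b x = 0]. On a wall with [x < k] all labels are at most [x], so
    label [k] is missing; the wall [x = k] is the face counted by [kuhn_count k]. *)
Lemma kuhn_countS : kuhn_count k.+1 = kuhn_count k.
Proof.
transitivity (\sum_(b | flat_base k.+1 b) \sum_(s | flat_perm k.+1 s)
  (\det (label_mx k (kuhn_point (incr ((s^-1)%g ok) (base b)) s)) +
   \det (label_mx k (kuhn_point (base b) s)))).
  apply: eq_bigr => b kb.
  under eq_bigr => s ks.
    rewrite det_label_mx; last by move=> r rk; apply: flat_lab_le.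
    over.
  rewrite /= exchange_big big_ord_recl big_ord_recr /=.
  rewrite [X in _ + (X + _)]big1 ?add0r; last first.
    by move=> r _; apply: face_mid; rewrite /bump //= add1n ltn_ord.
  rewrite big_split /=; congr (_ + _).
    rewrite [RHS](reindex_inj (mulIg rotate_perm)) /=.
    apply: eq_big => s; first by rewrite flat_permX// flat_rotate.
    by move=> ks; rewrite face_bot.
  by apply: eq_bigr => s _; rewrite /bump /= add1n face_top.
rewrite exchange_big /=.
under eq_bigr => s ks do rewrite big_split /= kuhn_telescope//.
rewrite (bigID (fun s => s ok == ok)) /= [X in _ + X]big1 ?addr0; last first.
  move=> s /andP[ks sk]; apply: big1 => b /andP[kb /eqP bx].
  have xk : ((s^-1)%g ok < k.+1)%N by rewrite -(flat_perm_lt _ ks) permKV.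
  have {}xk : ((s^-1)%g ok < k)%N.
    rewrite ltn_neqAle -ltnS xk andbT; apply: contra sk => /eqP e.
    by rewrite -{1}[ok]/(Ordinal kN) -[X in s X](_ : (s^-1)%g ok = _) ?permKV//; apply: val_inj.
  apply: (@det_col0 _ _ ord_max) => r; rewrite mxE; case: eqP => //= e.
  suff : (lab (kuhn_point (base b) s r) <= (s^-1)%g ok)%N by rewrite e leqNgt xk.
  apply: lab_bot => [i|]; first exact: kuhn_point_le.
  by rewrite /kuhn_point ?/base bx permKV /=; have := ltn_ord r; lia.
rewrite /kuhn_count exchange_big /=; apply: eq_big => s.
  apply/andP/forallP => [[/forallP ks sk] i|ks].
    rewrite leq_eqVlt; apply/implyP => /orP[/eqP ki|ki]; last exact: implyP (ks i) _.
    by have -> : i = ok by apply: val_inj.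
  split; last by apply: (implyP (ks ok)).
  by apply/forallP => i; apply/implyP => ki; apply: (implyP (ks i)); apply: ltnW.
move=> /andP[_ sk]; apply: eq_bigl => b.
have -> : (s^-1)%g ok = ok by apply: (@perm_inj _ s); rewrite permKV (eqP sk).
apply/andP/forallP => [[/forallP kb b0] i|kb].
  rewrite leq_eqVlt; apply/implyP => /orP[/eqP ki|ki]; last exact: implyP (kb i) _.
  by have -> : i = ok by apply: val_inj.
split; last by apply: (implyP (kb ok)).
by apply/forallP => i; apply/implyP => ki; apply: (implyP (kb i)); apply: ltnW.
Qed.

End step.

(** The count is 1 modulo 2, so some determinant is nonzero; its rows, hence the labels, are
    distinct. *)
Lemma kuhn : exists v : 'I_N.+1 -> 'I_N -> nat,
  [/\ forall j i, (v j i <= m)%N,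
      forall j j' i, (v j i <= (v j' i).+1)%N &
      injective (lab \o v)].
Proof.
have /eqP : kuhn_count N = 1.
  suff H k : (k <= N)%N -> kuhn_count k = 1 by exact: H.
  elim: k => [|k IH] kN; first exact: kuhn_count0.
  by rewrite kuhn_countS// IH// ltnW.
have [[b [s D]] _|H] := pselect (exists b s, \det (label_mx N (kuhn_point (base b) s)) != 0).
  exists (fun j => kuhn_point (base b) s j); split.
  - by move=> j i; apply: kuhn_point_le.
  - by move=> j j' i; rewrite /kuhn_point ?/base; lia.
  move=> i j /= ij; apply/eqP; apply: contra_neqT D => nij.
  by apply: (determinant_alternate nij) => c; rewrite !mxE ij.
rewrite /kuhn_count big1 // => b _; apply: big1 => s _.
by apply/eqP/negPn/negP => D; apply: H; exists b, s.
Qed.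

End kuhn.

(** * Covering dimension of cubes *)

Section covering.
Context {R : realType}.

Lemma metric_ball_open (T : metricType R) (x : T) (e : R) : open (ball x e).
Proof.
rewrite openE => y; rewrite /interior /= ballEmdist /= => xy.
apply/nbhs_ballP; exists (e - mdist x y); first by rewrite /= subr_gt0.
move=> z; rewrite !ballEmdist /= => yz.
by have := metric_triangle x y z; lra.
Qed.

Lemma row_dist_lt n (u v : 'rV[R]_n) e : 0 < e ->
  (forall i, `|u ord0 i - v ord0 i| < e) -> `|u - v| < e.
Proof.
move=> e0 H; have [->//|/mx_norm_neq0[[i j] /= ij]] := eqVneq `|u - v| 0.
by rewrite {1}/Num.norm /= ij !mxE [i]ord1.
Qed.

Lemma row_entry_le n (u v : 'rV[R]_n) i : `|u ord0 i - v ord0 i| <= `|u - v|.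
Proof.
have -> : u ord0 i - v ord0 i = (u - v) ord0 i by rewrite !mxE.
rewrite [X in _ <= X]/Num.norm/= mx_normrE.
exact: (le_bigmax _ (fun i => `|(u - v) i.1 i.2|) (ord0, i)).
Qed.

Definition cube n : set 'rV[R]_n := [set v : 'rV[R]_n | forall i, v ord0 i \in `[0, 1]].

(** Lebesgue's number lemma for the cover pulled back to the compact cube. *)
Lemma cube_lebesgue_number (T : metricType R) n (phi : 'rV[R]_n -> T) (C : R)
    (V : set (set T)) :
  (forall u v, cube u -> cube v -> mdist (phi u) (phi v) <= C * `|u - v|) ->
  (forall B, V B -> open B) -> \bigcup_(B in V) B = setT ->
  exists2 d : R, 0 < d & forall u, cube u ->
    exists2 B, V B & forall v, cube v -> `|u - v| < d -> B (phi v).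
Proof.
move=> lip Vo Vc.
have /compact_near_coveringP/(_ R (0^'+)) : compact (@cube n).
  have := @rV_compact R n (fun=> `[0, 1]%classic) (fun=> @segment_compact _ _ _).
  congr compact.
pose P d (u : 'rV[R]_n) := cube u ->
  exists2 B, V B & forall v, cube v -> `|u - v| < d -> B (phi v).
move=> /(_ P _) []; last first.
  move=> e /= e0 He; exists (e / 2); first by rewrite divr_gt0.
  move=> u Ku; apply: (He (e / 2)) => //=; last by rewrite divr_gt0.
  by rewrite sub0r normrN gtr0_norm ?divr_gt0//; lra.
move=> u Ku; have : setT (phi u) by [].
rewrite -Vc => -[B VB Bu].
have := Vo B VB; rewrite openE => /(_ _ Bu) /nbhs_ballP[r /= r0 rB].
(* [c] bounds both the distance from [u] to [u'] and the size [d], so points at distance less than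
   [2 * c] must have images less than [r] apart. The denominator is positive whatever the sign of
   [C]. *)
pose c := r / (2 * (`|C| + 1)).
have C1 : 0 < `|C| + 1 by rewrite ltr_wpDl.
have c0 : 0 < c by rewrite divr_gt0// mulr_gt0.
exists (ball u c, [set d : R | d < c]) => /=.
  split; first by apply/nbhs_ballP; exists c.
  by exists c => //= d; rewrite /ball_ /= sub0r normrN => dc _; apply: le_lt_trans dc; exact: ler_norm.
move=> [u' d] /= [uu' dc] Ku'; exists B => // v Kv u'v.
apply: rB; rewrite ballEmdist /=.
apply: le_lt_trans (lip _ _ Ku Kv) _.
have uv : `|u - v| < 2 * c.
  rewrite -ball_normE /= in uu'.
  by have := ler_distD u' u v; lra.
have := ler_norm C; have -> : r = (`|C| + 1) * (2 * c) by rewrite /c; field; rewrite gt_eqF.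
have := normr_ge0 (u - v); nra.
Qed.

(** Lebesgue's covering theorem. In a refinement of the cover by balls of radius [e / 2], no member
    meets the images of two opposite faces. Label a grid point [p] by the first [i] such that a
    chosen member [B p] around it meets the image of the face [u_i = 0]. Kuhn's lemma gives [n.+2]
    neighbouring points with distinct labels, hence [n.+2] distinct members with a common point. *)
Lemma covering_dim_cube (T : metricType R) n (phi : 'rV[R]_n.+1 -> T) (C e : R) :
  (forall u v, cube u -> cube v -> mdist (phi u) (phi v) <= C * `|u - v|) ->
  0 < e ->
  (forall u v i, cube u -> cube v -> u ord0 i = 0 -> v ord0 i = 1 ->
     e <= mdist (phi u) (phi v)) ->
  ~ covering_dim_le T n.
Proof.
move=> lip e0 sep dim.
have [||V [Vo Vc Vr Vcard]] := dim (range (fun x => ball x (e / 2))).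
- by move=> _ [x _ <-]; exact: metric_ball_open.
- apply/seteqP; split=> // x _; exists (ball x (e / 2)); first by exists x.
  by apply: ballxx; rewrite divr_gt0.
have [d d0 Hd] := cube_lebesgue_number lip Vo Vc.
have [m'] := ltr_add_invr d0; rewrite add0r => m'd.
set m := m'.+1 in m'd.
have m0 : 0 < m%:R :> R by [].
pose gp (p : 'I_n.+1 -> nat) : 'rV[R]_n.+1 := \row_i ((p i)%:R / m%:R).
have gpK p : (forall i, p i <= m)%N -> cube (gp p).
  move=> pm i; rewrite /= in_itv /= mxE; apply/andP; split.
    by rewrite divr_ge0.
  by rewrite ler_pdivrMr// mul1r ler_nat.
have /choice[B HB] p : exists B, (forall i, p i <= m)%N ->
    V B /\ forall v, cube v -> `|gp p - v| < d -> B (phi v).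
  have [pm|] := pselect (forall i, p i <= m)%N; last by exists set0.
  by have [B VB BH] := Hd _ (gpK _ pm); exists B.
pose touch p i := `[< exists u, [/\ cube u, u ord0 i = 0 & B p (phi u)] >].
(* [find] returns [n.+1] when no face is touched, which is the remaining label. *)
pose lab p := find (touch p) (enum 'I_n.+1).
have Bp p : (forall i, p i <= m)%N -> B p (phi (gp p)).
  by move=> pm; apply: (HB p pm).2; [exact: gpK | rewrite subrr normr0].
have [||p i pm pi|v [vm vv vinj]] := @kuhn n.+1 m' lab.
- by move=> p _; rewrite -[X in (_ <= X)%N](size_enum_ord n.+1) find_size.
- move=> p i pm pi; rewrite leqNgt; apply/negP => /(before_find ord0).
  rewrite nth_ord_enum => /asboolPn; apply; exists (gp p); split; first exact: gpK.
    by rewrite mxE pi mul0r.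
  exact: Bp.
- move=> li; have ht : has (touch p) (enum 'I_n.+1).
    by rewrite has_find -/(lab p) li size_enum_ord.
  have := nth_find ord0 ht; rewrite -/(lab p) li nth_ord_enum => /asboolP[u [Ku ui Bu]].
  have [_ [x _ <-] xB] := Vr _ (HB p pm).1.
  have := sep u (gp p) i Ku (gpK _ pm) ui; rewrite mxE pi divff ?gt_eqF// => /(_ erefl).
  have := Bp p pm; move/xB: Bu => xu /xB.
  move: xu; rewrite !ballEmdist /= => xu xp.
  have := metric_triangle (phi u) x (phi (gp p)); rewrite (metric_sym _ x); lra.
have /pcard_leP[f] := Vcard (phi (gp (v ord0))).
have fV j : [set A | V A /\ A (phi (gp (v ord0)))] (B (v j)).
  split; first by have [] := HB _ (vm j).
  apply: (HB _ (vm j)).2; first exact: gpK.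
  apply: row_dist_lt => // i; rewrite !mxE -mulrBl normrM [X in _ * X]ger0_norm ?invr_ge0//.
  apply: le_lt_trans m'd; rewrite ler_piMl ?invr_ge0// ler_norml.
  have := vv j ord0 i; have := vv ord0 j i; rewrite -!(ler_nat R) -!natr1; lra.
have fI j : (f (B (v j)) < n.+1)%N by exact: (@funS _ _ _ _ f _ (fV j)).
pose h j : 'I_n.+1 := Ordinal (fI j).
suff /leq_card : injective h by rewrite !card_ord ltnn.
move=> j j' /(congr1 val) /= fjj; apply: vinj.
have /= BB : B (v j) = B (v j').
  by apply: (@inj _ _ _ f) => //; rewrite inE; exact: fV.
by rewrite /= /lab /touch BB.
Qed.

End covering.

(** * The injective hull *)

Section hull.
Context {R : realType} {M : metricType R}.
Implicit Types (h k : M -> R) (x y z : M) (f g : injective_hull M).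

Definition admissible h := forall x y, mdist x y <= h x + h y.

Definition upper_polar h x : R := sup (range (fun y => mdist x y - h y)).

Lemma upper_polar_ge h x y : admissible h -> mdist x y - h y <= upper_polar h x.
Proof.
move=> hM; apply: ub_le_sup; last by exists y.
by exists (h x) => _ [z _ <-]; rewrite lerBlDr.
Qed.

Lemma upper_polar_le h x c :
  (forall y, mdist x y - h y <= c) -> upper_polar h x <= c.
Proof. by move=> H; apply: ge_sup => [|_ [y _ <-]//]; exists (mdist x x - h x), x. Qed.

Lemma upper_polar_near h x e : admissible h -> 0 < e ->
  exists y, upper_polar h x + h y <= mdist x y + e.
Proof.
move=> hM e0; have hs : has_sup (range (fun y => mdist x y - h y)).
  split; first by exists (mdist x x - h x), x.
  by exists (h x) => _ [z _ <-]; rewrite lerBlDr.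
by have [_ [y _ <-]] := sup_adherent e0 hs; exists y; rewrite /upper_polar; lra.
Qed.

Lemma hull_near f x e : 0 < e -> exists y, f x + f y <= mdist x y + e.
Proof. by move=> e0; rewrite [f x]hull_sup; apply: upper_polar_near => //; exact: hull_ge. Qed.

Lemma mk_hull h : admissible h ->
  (forall x e, 0 < e -> exists y, h x + h y <= mdist x y + e) ->
  exists f, f =1 h.
Proof.
move=> hM near; suff hE x : h x = upper_polar h x by exists (InjectiveHull hM hE).
apply/eqP; rewrite eq_le; apply/andP; split; last first.
  by apply: upper_polar_le => y; rewrite lerBlDr.
apply/ler_addgt0Pr => e e0; have [y xy] := near x e e0.
by have := upper_polar_ge x y hM; lra.
Qed.

Lemma mk_hull_exact h : admissible h ->
  (forall x, exists y, h x + h y = mdist x y) -> exists f, f =1 h.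
Proof.
move=> hM ex; apply: mk_hull => // x e e0.
by have [y xy] := ex x; exists y; rewrite xy lerDl ltW.
Qed.

(** The supremum is attained at [x], where [hull_point x] vanishes. *)
Lemma mdist_hull_point f x : mdist f (hull_point x) = f x.
Proof.
apply/eqP; rewrite eq_le; apply/andP; split.
  apply: hull_dist_le => [|y].
    by have := hull_ge f x x; rewrite mdistxx; lra.
  have := hull_ge f x y; have := hull_lipschitz f y x; rewrite (metric_sym y).
  by rewrite ler_norml /=; lra.
have := hull_dist_ge f (hull_point x) x; rewrite /= mdistxx subr0.
exact: le_trans (ler_norm _).
Qed.

(** One step of a nonexpansive retraction of the admissible functions onto the hull, whose elements
    are the admissible functions equal to their [upper_polar]. *)
Definition halfway h x : R := (h x + upper_polar h x) / 2.

Lemma upper_polar_le_id h x : admissible h -> upper_polar h x <= h x.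
Proof. by move=> hM; apply: upper_polar_le => y; rewrite lerBlDr. Qed.

Lemma halfway_le h x : admissible h -> halfway h x <= h x.
Proof. by move=> hM; rewrite /halfway; have := upper_polar_le_id x hM; lra. Qed.

Lemma admissible_halfway h : admissible h -> admissible (halfway h).
Proof.
move=> hM x y; have := upper_polar_ge x y hM; have := upper_polar_ge y x hM.
by rewrite (metric_sym y) /halfway; lra.
Qed.

Lemma le_upper_polar h k c : admissible h -> (forall x, h x <= k x + c) ->
  forall x, upper_polar k x <= upper_polar h x + c.
Proof.
move=> hM hk x; apply: upper_polar_le => y.
by have := upper_polar_ge x y hM; have := hk y; lra.
Qed.

Definition retract_seq h n := iter n halfway h.

Definition retract h x : R := inf (range (fun n => retract_seq h n x)).

Lemma admissible_retract_seq h n : admissible h -> admissible (retract_seq h n).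
Proof. by move=> hM; elim: n => //= n; exact: admissible_halfway. Qed.

Lemma retract_seq_mono h n j x : admissible h ->
  retract_seq h (j + n) x <= retract_seq h n x.
Proof.
move=> hM; elim: j => // j; apply: le_trans; apply: halfway_le.
exact: admissible_retract_seq.
Qed.

Lemma upper_polar_retract_seq h n j x : admissible h ->
  upper_polar (retract_seq h n) x <= upper_polar (retract_seq h (j + n)) x.
Proof.
move=> hM; rewrite -[leRHS]addr0; apply: le_upper_polar => [|z].
  exact: admissible_retract_seq.
by rewrite addr0 retract_seq_mono.
Qed.

Lemma upper_polar_le_retract_seq h n i x : admissible h ->
  upper_polar (retract_seq h n) x <= retract_seq h i x.
Proof.
move=> hM; apply: (@le_trans _ _ (retract_seq h (n + i) x)).
  rewrite addnC; apply: le_trans (upper_polar_retract_seq n i x hM) _.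
  by apply: upper_polar_le_id; exact: admissible_retract_seq.
exact: retract_seq_mono.
Qed.

Lemma upper_polar_le_retract h n x : admissible h ->
  upper_polar (retract_seq h n) x <= retract h x.
Proof.
move=> hM; apply: lb_le_inf; first by exists (retract_seq h 0 x), 0%N.
by move=> _ [i _ <-]; exact: upper_polar_le_retract_seq.
Qed.

Lemma retract_le h n x : admissible h -> retract h x <= retract_seq h n x.
Proof.
move=> hM; apply: ge_inf; last by exists n.
by exists (upper_polar h x) => _ [i _ <-]; exact: (upper_polar_le_retract_seq 0).
Qed.

(** A step moves to the midpoint of the function and its polar, while the polar can only grow; so
    the gap at least halves. *)
Lemma retract_gap h n x : admissible h ->
  retract_seq h n x - upper_polar (retract_seq h n) x <=
  (h x - upper_polar h x) / 2 ^+ n.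
Proof.
move=> hM; elim: n => [|n IH]; first by rewrite expr0 divr1.
rewrite exprS invfM mulrCA mulrC.
have := upper_polar_retract_seq n 1 x hM; rewrite add1n.
move: IH; have -> : retract_seq h n.+1 x = halfway (retract_seq h n) x by [].
rewrite /halfway.
by set p := upper_polar (retract_seq h n.+1) x; lra.
Qed.

Lemma retract_gap_lt h x e : admissible h -> 0 < e ->
  exists n, retract_seq h n x <= upper_polar (retract_seq h n) x + e.
Proof.
move=> hM e0; set c := h x - upper_polar h x.
have c0 : 0 <= c by rewrite subr_ge0 upper_polar_le_id.
have [i ie] := ltr_add_invr (divr_gt0 e0 (ltr_wpDl c0 ltr01)).
exists i; rewrite -lerBlDl; apply: le_trans (retract_gap i x hM) _.
rewrite -/c; rewrite add0r in ie.
have i2 : (2 ^+ i)^-1 <= i.+1%:R^-1 :> R.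
  by rewrite lef_pV2 ?posrE ?exprn_gt0// -natrX ler_nat ltn_expl.
move: ie; rewrite ltr_pdivlMr ?ltr_wpDl// => ie.
have i0 : 0 < i.+1%:R^-1 :> R by rewrite invr_gt0.
apply: le_trans (ler_wpM2l c0 i2) _; apply: ltW; apply: le_lt_trans ie.
by rewrite mulrDr mulr1 mulrC lerDl ltW.
Qed.

Lemma retract_hull h : admissible h -> exists f, f =1 retract h.
Proof.
move=> hM; apply: mk_hull => [x y|x e e0].
  apply/ler_addgt0Pr => e e0; have [n ny] := retract_gap_lt y hM e0.
  have := upper_polar_ge x y (admissible_retract_seq n hM).
  have := upper_polar_le_retract n x hM; have := upper_polar_le_retract n y hM.
  by lra.
have e2 : 0 < e / 2 by rewrite divr_gt0.
have [n nx] := retract_gap_lt x hM e2.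
have [y xy] := upper_polar_near x (admissible_retract_seq n hM) e2.
exists y; have := retract_le n x hM; have := retract_le n y hM; lra.
Qed.

(** Taking polars is nonexpansive for the sup norm, hence so is each step, and then the infimum. *)
Lemma le_retract h k c x : admissible h -> admissible k ->
  (forall x, `|h x - k x| <= c) -> retract h x <= retract k x + c.
Proof.
move=> hM kM hk; rewrite -lerBlDr; apply: lb_le_inf; first by exists (k x), 0%N.
move=> _ [n _ <-]; rewrite lerBlDr.
suff : `|retract_seq h n x - retract_seq k n x| <= c.
  by rewrite ler_norml; have := retract_le n x hM; lra.
elim: n x => //= n IH x; rewrite /halfway.
have hn := admissible_retract_seq n hM; have kn := admissible_retract_seq n kM.
have p1 : upper_polar (retract_seq k n) x <= upper_polar (retract_seq h n) x + c.
  by apply: le_upper_polar => // z; have := IH z; rewrite ler_norml; lra.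
have p2 : upper_polar (retract_seq h n) x <= upper_polar (retract_seq k n) x + c.
  by apply: le_upper_polar => // z; have := IH z; rewrite ler_norml; lra.
by have := IH x; rewrite !ler_norml; lra.
Qed.

Lemma retract_id f : retract f =1 f.
Proof.
have fM : admissible f by exact: hull_ge.
have hf : halfway f = f.
  apply/funext => x; rewrite /halfway.
  by have -> : upper_polar f x = f x by [rewrite [RHS]hull_sup]; lra.
have seqf n : retract_seq f n = f by elim: n => //= n ->.
move=> x; rewrite /retract.
have -> : range (fun n => retract_seq f n x) = [set (f x : R)].
  by apply/seteqP; split => [_ [n _ <-]|_ ->] /=; [rewrite seqf|exists 0%N].
exact: inf1.
Qed.

(** The affine segment from [f] to [g] consists of admissible functions; the retraction brings it
    into the hull without increasing distances and fixes both ends. *)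
Lemma hull_geodesic f g : exists c : R -> injective_hull M,
  [/\ c 0 = f, c 1 = g & forall s t, 0 <= s <= 1 -> 0 <= t <= 1 ->
      mdist (c s) (c t) <= `|s - t| * mdist f g].
Proof.
pose h s x := f x + s * (g x - f x).
have hM (s : R) : 0 <= s <= 1 -> admissible (h s).
  move=> /andP[s0 s1] x y; rewrite /h.
  by have := hull_ge f x y; have := hull_ge g x y; nra.
have /choice[c cE] (s : R) : exists F : injective_hull M, 0 <= s <= 1 -> F =1 retract (h s).
  have [/hM/retract_hull[F FE]|] := boolP (0 <= s <= 1); first by exists F.
  by exists f.
exists c; split.
- apply: hull_eq => x; rewrite cE ?lexx ?ler01//.
  by rewrite (_ : h 0 = f) ?retract_id//; apply/funext => y; rewrite /h mul0r addr0.
- apply: hull_eq => x; rewrite cE ?lexx ?ler01//.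
  by rewrite (_ : h 1 = g) ?retract_id//; apply/funext => y; rewrite /h; lra.
move=> s t s01 t01.
have hst x : `|h s x - h t x| <= `|s - t| * mdist f g.
  have -> : h s x - h t x = (s - t) * (g x - f x) by rewrite /h; ring.
  rewrite normrM ler_wpM2l// [leLHS]distrC; exact: (hull_dist_ge f g x).
apply: hull_dist_le => [|x]; first by rewrite mulr_ge0// mdist_ge0.
rewrite !cE//.
have := le_retract x (hM s s01) (hM t t01) hst.
have hts y : `|h t y - h s y| <= `|s - t| * mdist f g by rewrite distrC.
have := le_retract x (hM t t01) (hM s s01) hts.
by rewrite ler_norml; lra.
Qed.

End hull.

(** * Composing hull functions with maps compatible with the reflections s -> n - s *)

Section reflection.
Context {R : realType} {M : metricType R}.
Hypothesis mdist_nat : forall x y : M, exists n : nat, mdist x y = n%:R.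
Variable g : R -> R.
Hypothesis g_mono : {homo g : s t / s <= t}.
Hypothesis g_refl : forall (n : nat) s, g (n%:R - s) = n%:R - g s.
Implicit Types f : injective_hull M.

Let adm f : admissible (g \o f).
Proof.
move=> x y; have := hull_ge f x y; have [n ->] := mdist_nat x y => xy.
have /g_mono : n%:R - f y <= f x by lra.
by rewrite g_refl /=; lra.
Qed.

Lemma hull_comp_lipschitz (K : R) f : 0 <= K ->
  (forall s t, `|g s - g t| <= K * `|s - t|) ->
  exists F : injective_hull M, F =1 g \o f.
Proof.
move=> K0 lip; apply: mk_hull => [|x e e0]; first exact: adm.
(* A pair tight up to [d = e / (K + 1)] becomes tight up to [K * d < e] after composition. *)
have e1 : 0 < e / (K + 1) by rewrite divr_gt0// ltr_wpDl.
have [y] := hull_near f x e1; have [n xyn] := mdist_nat x y; rewrite xyn => xy.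
exists y => /=; set d := e / (K + 1) in xy e1.
have /g_mono : f x <= n%:R - (f y - d) by lra.
rewrite g_refl; have := lip (f y) (f y - d).
have -> : f y - (f y - d) = d by lra.
rewrite (gtr0_norm e1) ler_norml => /andP[_ l1] l2.
have : e = K * d + d by rewrite -[X in _ + X]mul1r -mulrDl /d mulrCA divff ?mulr1// gt_eqF// ltr_wpDl.
by move: l1 l2; rewrite xyn; lra.
Qed.

(** Exactly tight pairs are preserved without any continuity of [g]; this serves the discontinuous
    [round_at]. *)
Lemma hull_comp_exact f : (forall x, exists y, f x + f y = mdist x y) ->
  exists F : injective_hull M, F =1 g \o f.
Proof.
move=> ex; apply: mk_hull_exact => [|x]; first exact: adm.
have [y] := ex x; have [n xyn] := mdist_nat x y; rewrite xyn => xy.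
exists y; rewrite xyn /=; by have -> : f x = n%:R - f y by [lra]; rewrite g_refl; lra.
Qed.

End reflection.

(** * Distance to the integers and finiteness *)

Section zdist.
Context {R : realType}.
Implicit Types (s t : R).

Definition zdist s : R := Num.min (s - (Num.floor s)%:~R) ((Num.floor s + 1)%:~R - s).

Lemma zdist_ge0 s : 0 <= zdist s.
Proof.
rewrite le_min !subr_ge0 floor_le /=.
by apply: ltW; rewrite floorD1_gt.
Qed.

Lemma zdist_le s (n : int) : zdist s <= `|s - n%:~R|.
Proof.
rewrite ge_min; have [ns|sn] := leP n (Num.floor s).
  rewrite ger0_norm; last by rewrite subr_ge0 -floor_ge_int.
  by rewrite lerD2l lerN2 ler_int ns.
rewrite distrC ger0_norm; last first.
  by rewrite subr_ge0; apply: ltW; rewrite -floor_lt_int.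
by rewrite [X in _ || X]lerD2r ler_int lezD1 sn orbT.
Qed.

Lemma zdist_ex s : exists n : int, zdist s = `|s - n%:~R|.
Proof.
have fs : (Num.floor s)%:~R <= s by exact: floor_le.
have sf : s < (Num.floor s + 1)%:~R by exact: floorD1_gt.
rewrite /zdist minEle; case: ifP => _.
  by exists (Num.floor s); rewrite ger0_norm// subr_ge0.
by exists (Num.floor s + 1); rewrite distrC gtr0_norm// subr_gt0.
Qed.

Lemma zdist_le_half s : zdist s <= 2^-1.
Proof.
rewrite ge_min rmorphD /=; have [|] := leP (s - (Num.floor s)%:~R) 2^-1 => //= H.
by lra.
Qed.

Lemma zdist_reflect (n : int) s : zdist (n%:~R - s) = zdist s.
Proof.
suff le t : zdist (n%:~R - t) <= zdist t.
  by apply/eqP; rewrite eq_le le /= -{1}[s](subKr n%:~R) le.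
have [k ->] := zdist_ex t; apply: le_trans (zdist_le _ (n - k)) _.
have -> : n%:~R - t - (n - k)%:~R = k%:~R - t by rewrite rmorphB /=; ring.
by rewrite distrC.
Qed.

Lemma zdist_lipschitz s t : `|zdist s - zdist t| <= `|s - t|.
Proof.
suff le a b : zdist a <= zdist b + `|a - b|.
  by rewrite ler_norml; have := le s t; have := le t s; rewrite (distrC t); lra.
have [k ->] := zdist_ex b; apply: le_trans (zdist_le _ k) _.
by rewrite [leRHS]addrC; exact: ler_distD.
Qed.

Lemma zdistN s : zdist (- s) = zdist s.
Proof. by rewrite -[RHS](zdist_reflect 0) sub0r. Qed.

Lemma zdist_eq0 s : zdist s = 0 -> exists n : int, s = n%:~R.
Proof. by have [n ->] := zdist_ex s => /eqP; rewrite normr_eq0 subr_eq0 => /eqP ->; exists n. Qed.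

Lemma zdistD_eq0 s t : zdist (s + t) = 0 -> zdist s = zdist t.
Proof.
move=> /zdist_eq0[n nE]; have -> : s = n%:~R - t by rewrite -nE addrK.
exact: zdist_reflect.
Qed.

Lemma zdistB_eq0 s t : zdist (s - t) = 0 -> zdist s = zdist t.
Proof. by move=> /zdistD_eq0; rewrite zdistN. Qed.

Lemma zdist_double_eq0 s : zdist (s + s) = 0 -> zdist s = 0 \/ zdist s = 2^-1.
Proof.
move=> /zdist_eq0[n nE]; have [k kE] := zdist_ex s.
have := zdist_le_half s; rewrite kE => half.
(* [k] is nearest to [s] and [n = 2 s], so [n - 2 k] is -1, 0 or 1. *)
have H : `|n - k *+ 2| <= 1.
  rewrite -(ler_int R) intr_norm rmorphB /= mulr2n rmorphD /= -nE.
  have -> : s + s - (k%:~R + k%:~R) = 2 * (s - k%:~R) by ring.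
  by rewrite normrM ger0_norm//; lra.
have -> : s - k%:~R = (n - k *+ 2)%:~R / 2.
  by rewrite rmorphB /= mulr2n rmorphD /= -nE; field.
have [->|[->|->]] : n - k *+ 2 = 0 \/ n - k *+ 2 = 1 \/ n - k *+ 2 = -1 by lia.
- by left; rewrite mul0r normr0.
- by right; rewrite mul1r ger0_norm// invr_ge0.
- by right; rewrite mulN1r normrN ger0_norm// invr_ge0.
Qed.

Section bump.
Variables (rho c : R).

(** Tents of height [rho] around [c] and [- c] modulo 1, with opposite signs: the function is
    periodic and odd, so adding it to the identity respects the reflections. *)
Definition bump_fun s : R :=
  Num.max 0 (rho - zdist (s - c)) - Num.max 0 (rho - zdist (s + c)).

Lemma bump_fun_reflect (n : int) s : bump_fun (n%:~R - s) = - bump_fun s.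
Proof.
rewrite /bump_fun opprB (_ : n%:~R - s - c = n%:~R - (s + c)); last by ring.
by rewrite (_ : n%:~R - s + c = n%:~R - (s - c)) ?zdist_reflect//; ring.
Qed.

Lemma bump_fun_lipschitz s t : `|bump_fun s - bump_fun t| <= 2 * `|s - t|.
Proof.
have tent (k u v : R) : `|u - v| <= k -> `|Num.max 0 (rho - u) - Num.max 0 (rho - v)| <= k.
  by rewrite !ler_norml; case: (leP 0 (rho - u)); case: (leP 0 (rho - v)); lra.
have t1 := tent _ _ _ (zdist_lipschitz (s - c) (t - c)).
have t2 := tent _ _ _ (zdist_lipschitz (s + c) (t + c)).
move: t1 t2; rewrite opprD opprK addrACA [- c + c]addrC subrr addr0.
rewrite opprD addrACA subrr addr0 /bump_fun !ler_norml; lra.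
Qed.

Lemma bump_fun_le s : 0 <= rho -> `|bump_fun s| <= rho.
Proof.
move=> r0; have := zdist_ge0 (s - c); have := zdist_ge0 (s + c).
rewrite /bump_fun ler_norml.
by case: (leP 0 (rho - zdist (s - c))); case: (leP 0 (rho - zdist (s + c))); lra.
Qed.

Lemma bump_fun_eq0 s : rho <= zdist (s - c) -> rho <= zdist (s + c) -> bump_fun s = 0.
Proof.
by move=> H1 H2; rewrite /bump_fun !max_l ?subrr// subr_le0.
Qed.

Lemma bump_fun_center : 0 <= rho -> rho <= zdist (c + c) -> bump_fun c = rho.
Proof.
move=> r0 H; rewrite /bump_fun subrr (@max_l _ _ 0 (rho - zdist (c + c))) ?subr_le0//.
have -> : zdist 0 = 0.
  by apply/eqP; rewrite eq_le zdist_ge0 (le_trans (zdist_le _ 0))// subrr normr0.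
by rewrite !subr0 max_r.
Qed.

End bump.
End zdist.

(** * Finite dimension bounds the distances to the integers *)

Section finite_zdist.
Context {R : realType} {M : metricType R}.
Hypothesis mdist_nat : forall x y : M, exists n : nat, mdist x y = n%:R.
Implicit Types f : injective_hull M.

(** Adding to the identity the multiples [u_i] of small bumps around the values [f (x i)] gives
    monotone maps compatible with reflections; composed with [f], they map the cube into the hull.
    At [f (x i)] only bump [i] is nonzero, so evaluation at [x i] separates the faces [u_i = 0] and
    [u_i = 1]. *)
Lemma hull_cube n f (x : 'I_n.+1 -> M) (rho : R) : 0 < rho ->
  (forall i j, i != j -> rho <= zdist (f (x i) - f (x j))) ->
  (forall i j, rho <= zdist (f (x i) + f (x j))) ->
  ~ covering_dim_le (injective_hull M) n.
Proof.
move=> r0 sub add.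
(* There are [n.+1] bumps, each 2-Lipschitz: this factor makes the perturbation 1-Lipschitz, so that
   the perturbed identity is monotone. *)
set c : R := (2 * n.+1%:R)^-1.
have c0 : 0 < c by rewrite invr_gt0 mulr_gt0.
have nc : n.+1%:R * c = 2^-1 by rewrite /c invfM mulrCA divff ?mulr1// gt_eqF.
pose H i := bump_fun rho (f (x i)).
pose g (u : 'rV[R]_n.+1) (s : R) := s + c * \sum_i u ord0 i * H i s.
have sum_le (F : 'I_n.+1 -> R) k : (forall i, `|F i| <= k) -> `|c * \sum_i F i| <= k / 2.
  move=> Fk; rewrite normrM gtr0_norm//.
  apply: (@le_trans _ _ (c * (\sum_(i < n.+1) k))).
    rewrite ler_pM2l//; apply: le_trans (ler_norm_sum _ _ _) _.
    exact: ler_sum.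
  rewrite sumr_const card_ord -[k *+ _]mulr_natl mulrA [c * _]mulrC nc.
by rewrite [leLHS]mulrC.
have g_lip u s t : cube u -> `|(g u s - s) - (g u t - t)| <= `|s - t|.
  move=> Ku; have -> : g u s - s - (g u t - t) = c * \sum_i u ord0 i * (H i s - H i t).
    rewrite /g -[s + _ - s]addrAC subrr add0r -[t + _ - t]addrAC subrr add0r.
    rewrite -mulrBr -sumrB; congr (_ * _).
    by apply: eq_bigr => i _; rewrite [RHS]mulrBr.
  have -> : `|s - t| = 2 * `|s - t| / 2 by field.
  apply: sum_le => i.
  have := Ku i; rewrite in_itv /= => /andP[u0 u1].
  rewrite normrM ger0_norm//; apply: le_trans (bump_fun_lipschitz rho (f (x i)) s t).
  by apply: ler_piMl.
have /choice[phi phiE] (u : 'rV[R]_n.+1) : exists F : injective_hull M, cube u -> F =1 g u \o f.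
  have [Ku|] := pselect (cube u); last by exists f.
  suff [F FE] : exists F : injective_hull M, F =1 g u \o f by exists F.
  apply: (hull_comp_lipschitz mdist_nat _ _ (K := 2)) => //.
  - by move=> s t st; have := g_lip u s t Ku; rewrite [leRHS]distrC [leRHS]ger0_norm ?subr_ge0// ler_norml; lra.
  - move=> m s; rewrite /g opprD addrA; congr (_ + _); rewrite -mulrN -sumrN.
    congr (_ * _); apply: eq_bigr => i _; rewrite -mulrN; congr (_ * _).
    exact: (bump_fun_reflect rho (f (x i)) m).
  - move=> s t; have := g_lip u s t Ku; have := ler_norm (s - t).
    have := ler_norm (t - s); rewrite distrC !ler_norml; lra.
have phiB u v y : cube u -> cube v ->
    phi u y - phi v y = c * \sum_i (u ord0 i - v ord0 i) * H i (f y).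
  move=> Ku Kv; rewrite !phiE//= /g opprD addrACA subrr add0r -mulrBr -sumrB.
  by congr (_ * _); apply: eq_bigr => i _; rewrite mulrBl.
apply: (@covering_dim_cube _ _ n phi (rho / 2) (c * rho)).
- move=> u v Ku Kv; apply: hull_dist_le => [|y].
    by rewrite mulr_ge0// divr_ge0// ltW.
  rewrite phiB// mulrAC [rho * _]mulrC; apply: sum_le => i.
  rewrite normrM ler_pM// ?row_entry_le//.
  by apply: bump_fun_le; exact: ltW.
- by rewrite mulr_gt0.
move=> u v i Ku Kv u0 v1.
apply: le_trans (hull_dist_ge (phi u) (phi v) (x i)).
rewrite phiB// (bigD1 i)//= big1 ?addr0 => [|j ji]; last first.
  rewrite /H bump_fun_eq0 ?mulr0//.
  by apply: sub; rewrite eq_sym.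
by rewrite u0 v1 sub0r mulN1r mulrN normrN /H bump_fun_center ?ler_norm// ltW.
Qed.

(** Infinitely many values would provide [n.+1] distinct ones other than 0 and 1/2. Those two are
    avoided because there [f x] and [- f x] differ by an integer, and the two tents of the bump
    would cancel. *)
Lemma hull_finite_zdist n f : covering_dim_le (injective_hull M) n ->
  finite_set (range (zdist \o f)).
Proof.
move=> dim; apply: contrapT => inf.
have /infinite_set_fset : infinite_set (range (zdist \o f) `\` [set 0; 2^-1]).
  exact: infinite_setD.
move=> /(_ n.+1)[B0 B0sub]; set B : seq R := finmap.enum_fset B0 => Bn.
have Bsub y : y \in B -> (range (zdist \o f) `\` [set 0; 2^-1]) y := B0sub y.
have Bi (i : 'I_n.+1) : nth 0 B i \in B by rewrite mem_nth// (leq_trans (ltn_ord i)).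
have /choice[x xE] (i : 'I_n.+1) : exists x, zdist (f x) = nth 0 B i.
  by have [[y _ <-] _] := Bsub _ (Bi i); exists y.
have ne i j : i != j -> zdist (f (x i)) <> zdist (f (x j)).
  move=> ij; rewrite !xE => /eqP; rewrite nth_uniq ?finmap.fset_uniq//.
  - by move=> /eqP/val_inj e; rewrite e eqxx in ij.
  - by rewrite (leq_trans (ltn_ord i)).
  - by rewrite (leq_trans (ltn_ord j)).
have pos i : zdist (f (x i) + f (x i)) <> 0.
  move=> /zdist_double_eq0; rewrite xE.
  by have [_ /not_orP[]] := Bsub _ (Bi i) => ? ? [].
(* The 1 on the diagonal is a filler: differences matter for distinct indices only, sums for all
   pairs. *)
pose F (p : 'I_n.+1 * 'I_n.+1) : R :=
  Num.min (if p.1 == p.2 then 1 else zdist (f (x p.1) - f (x p.2)))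
          (zdist (f (x p.1) + f (x p.2))).
have F0 p : 0 < F p.
  rewrite lt_min; apply/andP; split.
    case: eqP => // /eqP/ne np; rewrite lt_neqAle zdist_ge0 andbT eq_sym.
    by apply/eqP => /zdistB_eq0.
  rewrite lt_neqAle zdist_ge0 andbT eq_sym; apply/eqP.
  have [->|/ne np] := eqVneq p.1 p.2; first exact: pos.
  by move=> /zdistD_eq0.
pose rho := \big[Num.min/1]_p F p.
have rhoF p : rho <= F p by exact: bigmin_le.
apply: (@hull_cube n f x rho) dim.
- by apply: lt_bigmin => // p _.
- by move=> i j ij; have := rhoF (i, j); rewrite /F /= (negPf ij) le_min => /andP[].
- by move=> i j; have := rhoF (i, j); rewrite /F /= le_min => /andP[].
Qed.

End finite_zdist.

(** * Cliques in Helly graphs *)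

Lemma total_min (T : eqType) (r : rel T) (s : seq T) (P : pred T) :
  {in s &, total r} -> transitive r -> has P s ->
  exists p, [/\ p \in s, P p & forall q, q \in s -> P q -> r p q].
Proof.
move=> rt rtr; elim: s rt => //= a s IH rt.
have rs : {in s &, total r} by move=> x y xs ys; apply: rt; rewrite inE ?xs ?ys orbT.
have raa : r a a by have := rt a a (mem_head _ _) (mem_head _ _); rewrite orbb.
have [hs _|hs] := boolP (has P s); last first.
  rewrite orbF => Pa; exists a; split; rewrite ?mem_head// => q.
  rewrite inE => /orP[/eqP ->//|qs Pq].
  by case/negP: hs; apply/hasP; exists q.
have [p [ps Pp pmin]] := IH rs hs.
have [/andP[Pa ap]|nap] := boolP (P a && r a p).
  exists a; split; rewrite ?mem_head// => q.
  rewrite inE => /orP[/eqP ->//|qs Pq]; exact: rtr ap (pmin q qs Pq).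
exists p; split; rewrite ?inE ?ps ?orbT// => q.
rewrite inE => /orP[/eqP -> Pa|]; last exact: pmin.
have := rt a p; rewrite !inE eqxx ps orbT => /(_ isT isT).
by move: nap; rewrite Pa /= => /negPf ->.
Qed.

Section graph.
Variable X : connected_graph.
Implicit Types (x y z u v : X) (p q : round_clique X).

Lemma gdist_le_walk n x y : walk (@adj X) n x y -> (gdist x y <= n)%N.
Proof. by move=> w; rewrite /gdist; case: ex_minnP => m _; apply; apply/asboolP. Qed.

Lemma walk_gdist x y : walk (@adj X) (gdist x y) x y.
Proof. by rewrite /gdist; case: ex_minnP => n /asboolP. Qed.

Lemma gdist_split x y r s : (gdist x y <= r + s)%N ->
  exists z, (gdist x z <= r)%N /\ (gdist z y <= s)%N.
Proof.
have split a b u v : walk (@adj X) (a + b) u v ->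
    exists2 z, walk (@adj X) a u z & walk (@adj X) b z v.
  elim: a u => [|a IH] u /=; first by exists u.
  by move=> [w uw /IH[z wz zv]]; exists z => //; exists w.
move=> xy; have := walk_gdist x y.
rewrite -(subnKC (geq_minr r (gdist x y))) => /split[z xz zy].
exists z; split; first by have := gdist_le_walk xz; lia.
by have := gdist_le_walk zy; lia.
Qed.

Lemma gdist_adj x y : adj x y -> (gdist x y <= 1)%N.
Proof. by move=> xy; apply: gdist_le_walk; exists y. Qed.

Lemma adj_gdist x y : (gdist x y <= 1)%N -> x <> y -> adj x y.
Proof.
move=> xy1 xy; have : gdist x y = 1%N.
  by apply/eqP; rewrite eqn_leq xy1 lt0n; apply/eqP => /gdist_eq0.
by move=> d1; have := walk_gdist x y; rewrite d1 => -[z xz <-].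
Qed.

Lemma clique_gdist p u v : rc_set p u -> rc_set p v -> (gdist u v <= 1)%N.
Proof.
move=> pu pv; have [->|uv] := pselect (u = v); first by rewrite gdistxx.
by apply: gdist_adj; apply: (rc_clique p).2.
Qed.

Lemma clique_inhab p : exists v, rc_set p v.
Proof. by have [[v pv] _] := rc_clique p; exists v. Qed.

Fact dmin_subproof p x : exists n, `[< exists2 v, rc_set p v & gdist x v = n >].
Proof. by have [v pv] := clique_inhab p; exists (gdist x v); apply/asboolP; exists v. Qed.

Fact dmax_subproof p x : exists n, `[< forall v, rc_set p v -> (gdist x v <= n)%N >].
Proof.
have [v pv] := clique_inhab p; exists (gdist x v).+1; apply/asboolP => u pu.
by have := gdist_triangle v x u; have := clique_gdist pv pu; lia.
Qed.

Definition dmin p x := ex_minn (dmin_subproof p x).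
Definition dmax p x := ex_minn (dmax_subproof p x).

Lemma dmin_le p v x : rc_set p v -> (dmin p x <= gdist x v)%N.
Proof.
by move=> pv; rewrite /dmin; case: ex_minnP => n _; apply; apply/asboolP; exists v.
Qed.

Lemma dmin_ex p x : exists2 v, rc_set p v & gdist x v = dmin p x.
Proof. by rewrite /dmin; case: ex_minnP => n /asboolP. Qed.

Lemma dmax_ge p v x : rc_set p v -> (gdist x v <= dmax p x)%N.
Proof. by move=> pv; rewrite /dmax; case: ex_minnP => n /asboolP + _; apply. Qed.

Lemma dmax_le p x n : (forall v, rc_set p v -> gdist x v <= n)%N -> (dmax p x <= n)%N.
Proof. by move=> H; rewrite /dmax; case: ex_minnP => m _; apply; apply/asboolP. Qed.

Lemma dmax_ex p x : exists2 v, rc_set p v & gdist x v = dmax p x.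
Proof.
apply: contrapT => H.
have lt v : rc_set p v -> (gdist x v < dmax p x)%N.
  move=> pv; rewrite ltn_neqAle dmax_ge// andbT; apply/eqP => e.
  by apply: H; exists v.
have [v pv] := clique_inhab p; have := lt v pv.
have : (dmax p x <= (dmax p x).-1)%N by apply: dmax_le => u /lt; lia.
by lia.
Qed.

Lemma dmin_le_dmax p x : (dmin p x <= dmax p x)%N.
Proof. by have [v pv <-] := dmin_ex p x; exact: dmax_ge. Qed.

Lemma dmax_le_dminS p x : (dmax p x <= (dmin p x).+1)%N.
Proof.
have [v pv <-] := dmin_ex p x; have [u pu <-] := dmax_ex p x.
by have := gdist_triangle v x u; have := clique_gdist pv pu; lia.
Qed.

Lemma rc_leP p q : reflect (p `<=` q) (p <= q)%O.
Proof. exact: asboolP. Qed.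

Lemma dmin_anti p q x : (p <= q)%O -> (dmin q x <= dmin p x)%N.
Proof. by move=> /rc_leP pq; have [v /pq qv <-] := dmin_ex p x; exact: dmin_le. Qed.

Lemma dmax_mono p q x : (p <= q)%O -> (dmax p x <= dmax q x)%N.
Proof. by move=> /rc_leP pq; apply: dmax_le => v /pq; exact: dmax_ge. Qed.

Lemma gdist_le_dmin_dmax p x y : (gdist x y <= dmin p x + dmax p y)%N.
Proof.
have [v pv <-] := dmin_ex p x; have := dmax_ge y pv; have := gdist_triangle v x y.
by rewrite (gdistC v y); lia.
Qed.

(** Every ball around [x] that contains [p] has radius at least [dmax p x], so a round [p] is the
    intersection of the balls with these radii. *)
Lemma round_dmax p v : (forall x, gdist x v <= dmax p x)%N -> rc_set p v.
Proof.
have [F pF] := rc_round p => H; rewrite pF => -[x r] Fxr /=.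
apply: leq_trans (H x) _; apply: dmax_le => u; rewrite pF => /(_ (x, r) Fxr).
by [].
Qed.

Lemma dmin_set1 v x : dmin (rc_set1 v) x = gdist x v.
Proof. by have [_ -> <-] := dmin_ex (rc_set1 v) x. Qed.

Lemma dmax_set1 v x : dmax (rc_set1 v) x = gdist x v.
Proof. by have [_ -> <-] := dmax_ex (rc_set1 v) x. Qed.

Hypothesis X_helly : helly X.

Lemma helly_center (r : X -> nat) : (forall x y, gdist x y <= r x + r y)%N ->
  exists z, forall x, (gdist x z <= r x)%N.
Proof.
move=> H; have [|z zF] := X_helly (F := [set w | w.2 = r w.1]).
  move=> [x n] [y m] /= -> ->; have [z [xz zy]] := gdist_split (H x y).
  by exists z; split => //=; rewrite /gball /= gdistC.
by exists z => x; apply: (zF (x, r x)).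
Qed.

(** Without such a [y], the balls of radius [dmax p] still meet pairwise after the radius at [x] is
    lowered by one. A common point lies in [p] by [round_dmax], yet is closer to [x] than
    [dmin p x]. *)
Lemma flat_antipode p x : dmin p x = dmax p x ->
  exists y, dmin p y = dmax p y /\ gdist x y = (dmax p x + dmax p y)%N.
Proof.
move=> flat; apply: contrapT => H.
(* A radius 0 cannot be lowered; then [x] is its own antipode. *)
have [k0|k0] := posnP (dmax p x).
  by apply: H; exists x; rewrite flat k0 gdistxx.
pose r y := if `[< y = x >] then (dmax p x).-1 else dmax p y.
have r_x : r x = (dmax p x).-1 by rewrite /r asboolT.
have r_n y : y <> x -> r y = dmax p y by move=> yx; rewrite /r asboolF.
have bnd y : y <> x -> (gdist x y <= r x + r y)%N.
  move=> yx; rewrite r_x r_n//; have := gdist_le_dmin_dmax p y x.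
  rewrite gdistC; have := dmin_le_dmax p y.
  have : ~ (dmin p y = dmax p y /\ gdist x y = (dmax p x + dmax p y)%N).
    by move=> e; apply: H; exists y.
  lia.
have [|z zr] := @helly_center r.
  move=> y z; have [->|yx] := pselect (y = x); have [->|zx] := pselect (z = x).
  - by rewrite gdistxx.
  - exact: bnd.
  - by rewrite gdistC addnC; exact: bnd.
  rewrite !r_n//; have := gdist_le_dmin_dmax p y z; have := dmin_le_dmax p y; lia.
have pz : rc_set p z.
  apply: round_dmax => y; apply: leq_trans (zr y) _; rewrite /r.
  by case: asboolP => [->|//]; exact: leq_pred.
have := zr x; have := dmin_le x pz; rewrite r_x; lia.
Qed.

(** Halved, the equation reads [cdist p x + cdist p y = d(x, y)]: a single [y] for the whole chain
    keeps averages over it extremal. Call [p] flat when its vertices are equally far from [x]. The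
    antipode of the largest flat member works if no non-flat member reaches farther from [x] than a
    flat one ([flatB]); otherwise a vertex farthest from [x] in the smallest non-flat member
    works. *)
Lemma chain_antipode (s : seq (round_clique X)) x : s != [::] ->
  {in s &, forall p q, (p >=< q)%O} ->
  exists y, forall p, p \in s ->
    (dmin p x + dmax p x + (dmin p y + dmax p y) = (gdist x y).*2)%N.
Proof.
move=> s0 sc; pose nf p := dmin p x != dmax p x.
have Hmm p : (dmin p x <= dmax p x <= (dmin p x).+1)%N.
  by rewrite dmin_le_dmax dmax_le_dminS.
have flatB : has (predC nf) s -> (forall p, p \in s -> ~~ nf p -> forall q, q \in s -> nf q -> dmax q x <= dmax p x)%N ->
  exists y, forall p, p \in s ->
    (dmin p x + dmax p x + (dmin p y + dmax p y) = (gdist x y).*2)%N.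
  move=> hf nfl; have tot : {in s &, total (fun p q : round_clique X => (q <= p)%O)}.
    by move=> a b as_ bs; have := sc b a bs as_.
  have [|t [ts tf tmax]] := total_min tot _ hf; first by move=> a b c ba cb; exact: le_trans cb ba.
  have /eqP tfl : dmin t x == dmax t x by rewrite -[_ == _]negbK.
  have [y [yfl xy]] := flat_antipode tfl; exists y => q qs.
  have [qf|qnf] := boolP (predC nf q).
    have qt : (q <= t)%O by exact: tmax.
    have := dmin_anti x qt; have := dmax_mono x qt; have := dmin_anti y qt; have := dmax_mono y qt.
    by have := dmin_le_dmax q x; have := dmin_le_dmax q y; lia.
  have tq : (t <= q)%O.
    have /orP[//|qt] := sc t q ts qs; case/negP: qnf => /=.
    have := dmin_anti x qt; have := dmax_mono x qt; have := dmin_le_dmax q x.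
    by rewrite /nf; lia.
  have qn : nf q by move: qnf; rewrite /= negbK.
  have := nfl t ts tf q qs qn; move: qn; rewrite /nf => /eqP qn.
  have := dmin_anti x tq; have := dmax_mono x tq; have := dmin_anti y tq; have := dmax_mono y tq.
  have := Hmm q; have := dmin_le_dmax q y; have := dmax_le_dminS q y.
  by have := gdist_le_dmin_dmax q x y; lia.
have [hnf|] := boolP (has nf s); last first.
  move=> hnf; apply: flatB.
    by case: s s0 hnf {sc} => //= a s _; rewrite negb_or => /andP[-> _].
  move=> p ps _ q qs qn; case/negP: hnf; apply/hasP; by exists q.
have tot : {in s &, total (fun p q : round_clique X => (p <= q)%O)} by move=> a b as_ bs; exact: sc.
have [|p0 [p0s p0n p0min]] := total_min tot _ hnf; first by move=> a b c; exact: le_trans.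
(* Up the chain [dmin] can only fall and [dmax] only grow, while they differ by 1 for non-flat
   members; hence both stay constant. *)
have nfE q : q \in s -> nf q -> (dmin q x = dmin p0 x /\ dmax q x = dmax p0 x)%N.
  move=> qs qn; have p0q := p0min q qs qn; move: p0n qn; rewrite /nf.
  by have := dmin_anti x p0q; have := dmax_mono x p0q; have := Hmm q; have := Hmm p0; lia.
have [hB|hA] := boolP (has (fun t => ~~ nf t && (dmax t x == dmax p0 x)) s).
  have /hasP[t0 t0s /andP[t0f /eqP t0x]] := hB.
  apply: flatB; first by apply/hasP; exists t0.
  move=> p ps pf q qs qn; rewrite (nfE q qs qn).2 -t0x.
  have [pt|tp] := orP (sc p t0 ps t0s); last exact: dmax_mono.
  move: pf t0f; rewrite /nf !negbK => /eqP pf /eqP t0f.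
  by have := dmin_anti x pt; have := dmax_mono x pt; lia.
(* In this case flat members lie below [p0], at distance [dmax p0 x - 1] from [x] and 1 from [y]. *)
have [y p0y xy] := dmax_ex p0 x; exists y => q qs.
have p0E : dmax p0 x = (dmin p0 x).+1 by move: p0n; rewrite /nf; have := Hmm p0; lia.
have [qn|qf] := boolP (nf q).
  have [e1 e2] := nfE q qs qn; have /rc_leP p0q := p0min q qs qn.
  have := dmin_le y (p0q _ p0y); rewrite gdistxx => dy.
  have [v qv xv] := dmin_ex q x; have := dmax_ge y qv.
  have := gdist_triangle v x y; rewrite (gdistC v); have := dmax_le_dminS q y; lia.
have qp0 : (q <= p0)%O.
  have [//|p0q] := orP (sc q p0 qs p0s).
  move: qf; rewrite /nf negbK => /eqP.
  by have := dmin_anti x p0q; have := dmax_mono x p0q; lia.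
have qx : dmax q x <> dmax p0 x.
  by move=> e; case/negP: hA; apply/hasP; exists q => //; rewrite qf e eqxx.
have one v : rc_set q v -> gdist y v = 1%N.
  move=> qv; have := rc_leP _ _ qp0 v qv => p0v.
  have := clique_gdist p0y p0v; have := dmax_ge x qv; have := dmax_mono x qp0.
  by have := gdist_triangle v x y; rewrite (gdistC v y); lia.
have [u qu yu] := dmin_ex q y; have [w qw yw] := dmax_ex q y.
move: yu yw; rewrite !one// => <- <-; rewrite xy.
move: qf; rewrite /nf negbK => /eqP qf.
have := dmin_anti x qp0; have := dmax_mono x qp0; lia.
Qed.

Variable R : realType.

Lemma mdist_graph (x y : graph_space R X) : mdist x y = (@gdist X x y)%:R.
Proof. by []. Qed.

Definition cdist p x : R := (dmin p x + dmax p x)%:R / 2.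

(** With [n = 2 f], the clique is the intersection of the balls of radius [n x / 2] rounded up. By
    the Helly property these balls still have a common point when one radius is rounded down
    instead, and this identifies [dmin] and [dmax] as the two roundings of [n x / 2]. *)
Lemma half_integral_hull (f : injective_hull (graph_space R X)) :
  (forall x, exists n : nat, f x = n%:R / 2) -> exists p, f =1 cdist p.
Proof.
move=> /choice[n nE].
have ge x y : ((gdist x y).*2 <= n x + n y)%N.
  rewrite -(ler_nat R) -muln2 natrM natrD; have := hull_ge f x y.
  by rewrite !nE mdist_graph; lra.
have ex x : exists y, (n x + n y = (gdist x y).*2)%N.
  (* [n] is integral, so slack 1/4 for [f], that is 1/2 for [n], forces equality. *)
  have e0 : 0 < 4^-1 :> R by rewrite invr_gt0.
  have [y H] := hull_near f x e0; exists y; apply/eqP; rewrite eqn_leq ge andbT.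
  rewrite -ltnS -(ltr_nat R) -muln2 -natr1 natrM natrD.
  by move: H; rewrite !nE mdist_graph; lra.
pose M x := uphalf (n x).
pose C : set X := [set v | forall x, (gdist x v <= M x)%N].
have C_ge v x : C v -> ((n x)./2 <= gdist x v)%N.
  move=> Cv; have [y xy] := ex x; have := Cv y; have := gdist_triangle v x y.
  by rewrite (gdistC v) /M; lia.
have C_half x : exists2 v, C v & gdist x v = (n x)./2.
  pose r y := if `[< y = x >] then (n x)./2 else M y.
  have [|v vr] := @helly_center r.
    move=> y z; have := ge y z; rewrite /r /M.
    case: asboolP => [->|yx]; case: asboolP => [->|zx]; rewrite ?gdistxx; lia.
  have Cv : C v.
    by move=> y; apply: leq_trans (vr y) _; rewrite /r /M; case: asboolP => [->|_]; lia.
  exists v => //; have := C_ge v x Cv; have := vr x; rewrite /r asboolT//; lia.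
have C_up x : exists2 v, C v & gdist x v = M x.
  (* A vertex of [C] nearest to a tight partner of [x] is farthest from [x]. *)
  have [y xy] := ex x; have [v Cv yv] := C_half y; exists v => //.
  have := Cv x; have := gdist_triangle v x y; rewrite (gdistC v) /M; lia.
have [x0 _] := X_helly (F := set0) (fun _ _ (h : False) => match h with end).
have Cclique : is_clique C.
  split; first by have [v] := C_half x0; exists v.
  move=> u v Cu Cv uv; apply: adj_gdist => //.
  (* As [u] is at distance 0 from itself, [n u <= 1], and all members lie within distance 1 of
     [u]. *)
  have := Cv u; have := C_ge u u Cu; rewrite gdistxx /M; lia.
have Cround : is_round C.
  exists [set w | w.2 = M w.1]; apply/seteqP; split => [v Cv [x r] /= ->|v H x].
    exact: Cv.
  exact: (H (x, M x)).
exists (RoundClique Cclique Cround) => x; rewrite nE /cdist; congr (_%:R / 2).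
set p := RoundClique _ _.
have -> : dmin p x = (n x)./2.
  have [v Cv xv] := C_half x; have := @dmin_le p v x Cv.
  by have [u Cu <-] := dmin_ex p x; have := C_ge u x Cu; lia.
have -> : dmax p x = M x.
  have [v Cv xv] := C_up x; have := @dmax_ge p v x Cv.
  by have [u Cu <-] := dmax_ex p x; have := Cu x; lia.
by rewrite /M; lia.
Qed.

End graph.

(** * The realization and its map to the hull *)

Section expectation.
Context {R : realType} {d : Order.disp_t} {P : porderType d}.
Implicit Types (a b : realization R P) (F G : P -> R) (p q : P).

Definition expect a F : R := \sum_(p \in [set: P]) a p * F p.

Definition supp a : seq P := finmap.enum_fset (fset_set [set p | a p != 0]).

Lemma mem_supp a p : (p \in supp a) = (a p != 0).
Proof.
have := in_fset_set (bary_finite a) p; rewrite /supp => ->.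
by apply/idP/idP; rewrite inE.
Qed.

Lemma supp_uniq a : uniq (supp a). Proof. exact: finmap.fset_uniq. Qed.

Lemma sum_widen_seq (h F : P -> R) (s : seq P) : uniq s ->
  (forall p, h p != 0 -> p \in s) ->
  \sum_(p \in [set: P]) h p * F p = \sum_(p <- s) h p * F p.
Proof.
move=> us hs; rewrite -(fsbig_widen [set` s])//; first by rewrite [RHS]fsbig_seq.
move=> p [_ ps]; rewrite /preimage /=.
have [->|/hs ps'] := eqVneq (h p) 0; first by rewrite mul0r.
by case: (ps ps').
Qed.

Lemma expect_seq a F s : uniq s -> (forall p, a p != 0 -> p \in s) ->
  expect a F = \sum_(p <- s) a p * F p.
Proof. exact: sum_widen_seq. Qed.

Lemma expectE a F : expect a F = \sum_(p <- supp a) a p * F p.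
Proof. by apply: expect_seq => [|p]; [exact: supp_uniq|rewrite mem_supp]. Qed.

Lemma expect_cst a (c : R) : expect a (fun=> c) = c.
Proof.
rewrite expectE -big_distrl /=; suff -> : \sum_(p <- supp a) a p = 1 by rewrite mul1r.
rewrite -[RHS](bary_sum a).
under [RHS]eq_fsbigr do rewrite -[bary a _]mulr1.
by rewrite -/(expect a (fun=> 1)) expectE; under [RHS]eq_bigr do rewrite mulr1.
Qed.

Lemma expectD a F G : expect a (fun p => F p + G p) = expect a F + expect a G.
Proof. by rewrite !expectE -big_split; apply: eq_bigr => p _; rewrite mulrDr. Qed.

Lemma expectZ a (c : R) F : expect a (fun p => c * F p) = c * expect a F.
Proof. by rewrite !expectE big_distrr; apply: eq_bigr => p _; rewrite mulrCA. Qed.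

Lemma expect_le a F G : (forall p, a p != 0 -> F p <= G p) -> expect a F <= expect a G.
Proof.
move=> FG; rewrite !expectE big_seq [leRHS]big_seq; apply: ler_sum => p.
by rewrite mem_supp => /FG; apply: ler_wpM2l; exact: bary_ge0.
Qed.

Lemma eq_expect a F G : (forall p, a p != 0 -> F p = G p) -> expect a F = expect a G.
Proof. by move=> FG; apply/eqP; rewrite eq_le !expect_le// => p /FG ->. Qed.

Lemma expect_eq1 a p : expect a (fun q => (q == p)%:R) = a p.
Proof.
have [ap|ap] := eqVneq (a p) 0.
  rewrite -[RHS](expect_cst a); rewrite ap; apply: eq_expect => q.
  by have [->|//] := eqVneq q p; rewrite ap eqxx.
rewrite expectE (big_rem p) ?mem_supp//= eqxx mulr1 big_seq big1 ?addr0// => q.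
by rewrite mem_rem_uniq ?supp_uniq// inE => /andP[/negPf ->]; rewrite mulr0.
Qed.

Lemma expect_vertex p F : expect (realization_vertex R p) F = F p.
Proof.
rewrite (@expect_seq _ _ [:: p])//; last first.
  by move=> q /=; rewrite pnatr_eq0 eqb0 negbK inE.
by rewrite big_seq1 /= eqxx mul1r.
Qed.

Lemma supp_neq0 a : supp a != [::].
Proof.
apply/eqP => s0; have := expect_cst a 1.
by rewrite expectE s0 big_nil => /esym/eqP; rewrite oner_eq0.
Qed.

Lemma expect_chain a F k (v : 'I_k.+1 -> P) :
  (forall i j : 'I_k.+1, (i < j)%N -> (v i < v j)%O) ->
  [set p | a p != 0] `<=` range v -> expect a F = \sum_(i < k.+1) a (v i) * F (v i).
Proof.
move=> vlt av; have vinj : injective v.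
  move=> i j vij; apply: val_inj.
  by case: (ltngtP i j) => // /vlt; rewrite vij ltxx.
rewrite (@expect_seq _ _ (codom v)).
- by rewrite big_image.
- by rewrite map_inj_uniq ?enum_uniq.
by move=> p /av[i _ <-]; exact: codom_f.
Qed.

Lemma sum_chain1 a k (v : 'I_k.+1 -> P) :
  (forall i j : 'I_k.+1, (i < j)%N -> (v i < v j)%O) ->
  [set p | a p != 0] `<=` range v -> \sum_(i < k.+1) a (v i) = 1.
Proof.
move=> vlt av; rewrite -[RHS](expect_cst a) (expect_chain _ vlt av).
by apply: eq_bigr => i _; rewrite mulr1.
Qed.

Lemma realization_eq a b : a =1 b -> a = b.
Proof.
case: a b => [a a1 a2 a3 a4] [b b1 b2 b3 b4] /= /funext ab.
by case: b / ab b1 b2 b3 b4 => *; congr Realization; exact: Prop_irrelevance.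
Qed.

Lemma chain_simplex (s : seq P) : s != [::] -> {in s &, forall p q, (p >=< q)%O} ->
  exists k (v : 'I_k.+1 -> P), (forall i j : 'I_k.+1, (i < j)%N -> (v i < v j)%O) /\
    [set` s] `<=` range v.
Proof.
case: s => // p0 s _ sc; set u := sort <=%O (undup (p0 :: s)).
have mu p : (p \in u) = (p \in p0 :: s) by rewrite mem_sort mem_undup.
have su : sorted <%O u.
  rewrite lt_sorted_uniq_le sort_uniq undup_uniq /=.
  apply: (sort_sorted_in (P := mem (p0 :: s))) => [p q ps qs|]; first exact: sc.
  by apply/allP => p; rewrite mem_undup.
have u0 : (0 < size u)%N by rewrite lt0n; apply/eqP => /size0nil e; have := mu p0; rewrite e mem_head.
have uk := prednK u0; exists (size u).-1, (fun i => nth p0 u i); split => [i j ij|p].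
  by rewrite (lt_sorted_ltn_nth p0 su)// inE (leq_trans (ltn_ord _))// uk.
rewrite /= -mu => pu; have pk : (index p u < (size u).-1.+1)%N by rewrite uk index_mem.
by exists (Ordinal pk) => //=; rewrite nth_index.
Qed.

(** The family [t] may repeat an element; the weights of equal entries are added. *)
Lemma realization_mixture n (w : 'I_n -> R) (t : 'I_n -> P) :
  (forall i, 0 <= w i) -> (forall i j, (t i >=< t j)%O) -> \sum_i w i = 1 ->
  exists a, forall F, expect a F = \sum_i w i * F (t i).
Proof.
move=> w0 tc w1; pose h p := \sum_(i | t i == p) w i.
have ht p : h p != 0 -> p \in undup (codom t).
  rewrite mem_undup; apply: contraNT => pt; apply/eqP; apply: big1 => i /eqP ti.
  by case/negP: pt; rewrite -ti codom_f.
have hE F : \sum_(p \in [set: P]) h p * F p = \sum_i w i * F (t i).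
  rewrite (@sum_widen_seq _ _ (undup (codom t)))//; last exact: undup_uniq.
  under eq_bigr do rewrite big_distrl big_mkcond /=.
  rewrite exchange_big /=; apply: eq_bigr => i _.
  rewrite -big_mkcond /= (big_rem (t i)) ?mem_undup ?codom_f//= eqxx.
  rewrite big_seq_cond big1 ?addr0// => p /andP[].
  by rewrite mem_rem_uniq ?undup_uniq// inE eq_sym => /andP[/negPf ->].
have h0 p : 0 <= h p by exact: sumr_ge0.
have hf : finite_set [set p | h p != 0].
  by apply: (sub_finite_set (B := [set` undup (codom t)])); [exact: ht|exact: finite_seq].
have hc p q : h p != 0 -> h q != 0 -> (p >=< q)%O.
  move=> /ht; rewrite mem_undup => /codomP[i ->] /ht.
  by rewrite mem_undup => /codomP[j ->].
have h1 : \sum_(p \in [set: P]) h p = 1.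
  rewrite -w1; transitivity (\sum_(p \in [set: P]) h p * 1).
    by apply: eq_fsbigr => p _; rewrite mulr1.
  by rewrite hE; apply: eq_bigr => i _; rewrite mulr1.
by exists (Realization h0 hf hc h1) => F; exact: hE.
Qed.

Lemma orthopointE l k (v : 'I_k.+1 -> P) a j :
  orthopoint l v a ord0 j = \sum_(i < k.+1) a (v i) * (if (j < i)%N then l else 0).
Proof. by rewrite /orthopoint summxE; apply: eq_bigr => i _; rewrite !mxE. Qed.

End expectation.

(** Summation by parts. When [al] is a difference of barycentric coordinates, the inner sums are
    differences of orthoscheme coordinates, up to the edge length. *)
Lemma abel_sum (R : realType) k (al h : nat -> R) : \sum_(i < k.+1) al i = 0 ->
  \sum_(i < k.+1) al i * h i =
  \sum_(j < k) (h j.+1 - h j) * \sum_(i < k.+1) al i * (j < i)%N%:R.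
Proof.
move=> al0; have hE i : (i < k.+1)%N -> h i = h 0%N + \sum_(j < k) (h j.+1 - h j) * (j < i)%N%:R.
  move=> ik; rewrite -(big_mkord xpredT (fun j => (h j.+1 - h j) * (j < i)%N%:R)).
  rewrite (big_cat_nat (n := i)) //=.
  rewrite [X in _ + (_ + X)]big_nat_cond [X in _ + (_ + X)]big1 ?addr0; last first.
    by move=> j /andP[/andP[ij _] _]; rewrite ltnNge ij mulr0.
  rewrite big_nat_cond (eq_bigr (fun j => h j.+1 - h j)); last first.
    by move=> j /andP[/andP[_ ->] _]; rewrite mulr1.
  by rewrite -big_nat_cond telescope_sumr// addrC subrK.
under eq_bigr => i _ do rewrite hE// mulrDr.
rewrite big_split /= -big_distrl /= al0 mul0r add0r.
under eq_bigr => i _ do rewrite big_distrr /=.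
rewrite exchange_big /=; apply: eq_bigr => j _; rewrite big_distrr /=.
by apply: eq_bigr => i _; rewrite mulrCA.
Qed.

(** * The map from the realization to the hull, and its restriction to a simplex *)

Section phi.
Context {R : realType} {X : connected_graph}.
Implicit Types (a b : realization R (round_clique X)) (p q : round_clique X) (x y : X).

Lemma cdist_ex a : helly X ->
  exists f : injective_hull (graph_space R X), f =1 fun x => expect a (fun p => cdist R p x).
Proof.
move=> X_helly; apply: mk_hull_exact => [x y|x].
  rewrite -expectD -(expect_cst a (mdist x y)); apply: expect_le => p _.
  rewrite mdist_graph /cdist -mulrDl ler_pdivlMr// -natrM -natrD ler_nat.
  have := gdist_le_dmin_dmax p x y; have := gdist_le_dmin_dmax p y x.
  by rewrite (gdistC y) muln2; lia.
have [|y xy] := chain_antipode X_helly x (supp_neq0 a).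
  by move=> p q; rewrite !mem_supp; exact: bary_chain.
exists y; rewrite -expectD -[RHS](expect_cst a); apply: eq_expect => p ap.
rewrite mdist_graph /cdist -mulrDl -natrD xy ?mem_supp// -muln2 natrM mulfK//.
Qed.

Variable phi : realization R (round_clique X) -> injective_hull (graph_space R X).
Hypothesis phiE : forall a x, phi a x = expect a (fun p => cdist R p x).

(** The vertices of [p] differ from [x] and share the clique [q] with it, so all are at distance 1
    from [x]. *)
Lemma cdist_outside p q x : (p <= q)%O -> rc_set q x -> ~ rc_set p x -> cdist R p x = 1.
Proof.
move=> /rc_leP pq qx px; have one v : rc_set p v -> gdist x v = 1%N.
  move=> pv; have := clique_gdist qx (pq _ pv).
  by rewrite leq_eqVlt ltnS leqn0 => /orP[/eqP//|/eqP/gdist_eq0 e]; rewrite e in px.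
have [u pu xu] := dmin_ex p x; have [v pv xv] := dmax_ex p x.
by rewrite /cdist -xu -xv !one// divff.
Qed.

Lemma cdist_inside p u x : rc_set p x -> rc_set p u -> u <> x -> cdist R p x = 2^-1.
Proof.
move=> px pu ux; have := dmin_le x px; rewrite gdistxx leqn0 => /eqP m0.
have := dmax_le_dminS p x; have := dmax_ge x pu; have := gdist_eq0 (x := x) (y := u).
rewrite m0 => H1 H2 H3; rewrite /cdist m0 (_ : dmax p x = 1%N) ?mul1r//.
by case: (gdist x u) H1 H2 => [/(_ erefl) e|n]; [rewrite e in ux|lia].
Qed.

Lemma rc_ltP p q : (p < q)%O -> exists x, rc_set q x /\ ~ rc_set p x.
Proof.
move=> pq; apply: contrapT => H; have : (q <= p)%O.
  by apply/rc_leP => x qx; apply: contrapT => px; apply: H; exists x.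
by move=> /(lt_le_trans pq); rewrite ltxx.
Qed.

Section simplex.
Variables (k : nat) (v : 'I_k.+1 -> round_clique X).
Hypothesis v_lt : forall i j : 'I_k.+1, (i < j)%N -> (v i < v j)%O.

Let v_le (i j : 'I_k.+1) : (i <= j)%N -> (v i <= v j)%O.
Proof. by rewrite leq_eqVlt => /orP[/eqP/val_inj ->//|/v_lt/ltW]. Qed.

(** Up the chain [dmin] falls and [dmax] grows, so each increment of [cdist] is bounded by that of
    [(dmax - dmin) / 2]. These telescope, and the last value is at most 1/2. *)
Lemma cdist_variation x (vi := fun j : nat => v (inord j)) :
  \sum_(j < k) `|cdist R (vi j.+1) x - cdist R (vi j) x| <= 2^-1.
Proof.
apply: (@le_trans _ _ (\sum_(0 <= j < k)
  (((dmax (vi j.+1) x)%:R - (dmin (vi j.+1) x)%:R) / 2 - ((dmax (vi j) x)%:R - (dmin (vi j) x)%:R) / 2))).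
  rewrite big_mkord; apply: ler_sum => j _.
  have le : (vi j <= vi j.+1)%O by apply: v_le; rewrite !inordK// ltnS// ltnW.
  have := dmin_anti x le; have := dmax_mono x le; rewrite -!(ler_nat R) /cdist !natrD ler_norml; lra.
rewrite telescope_sumr//.
have := dmax_le_dminS (vi k) x; have := dmin_le_dmax (vi 0%N) x.
rewrite -!(ler_nat R) -natr1; lra.
Qed.

Variables a b : realization R (round_clique X).
Hypothesis av : [set p | a p != 0] `<=` range v.
Hypothesis bv : [set p | b p != 0] `<=` range v.

(** Summation by parts gives the variation of [cdist], at most 1/2, times twice the largest
    coordinate difference; the factor 2 undoes the edge length. *)
Lemma orthopoint_dist_le x :
  `|phi a x - phi b x| <= `|orthopoint 2^-1 v a - orthopoint 2^-1 v b|.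
Proof.
set n := leRHS; pose al i : R := a (v (inord i)) - b (v (inord i)).
pose h i : R := cdist R (v (inord i)) x.
have -> : phi a x - phi b x = \sum_(i < k.+1) al i * h i.
  rewrite !phiE (expect_chain _ v_lt av) (expect_chain _ v_lt bv) -sumrB.
  by apply: eq_bigr => i _; rewrite /al /h inord_val mulrBl.
rewrite abel_sum; last first.
  under eq_bigr do rewrite /al inord_val.
  by rewrite sumrB (sum_chain1 v_lt av) (sum_chain1 v_lt bv) subrr.
apply: le_trans (ler_norm_sum _ _ _) _.
apply: (@le_trans _ _ (\sum_(j < k) `|h j.+1 - h j| * (2 * n))).
  apply: ler_sum => j _; rewrite normrM ler_wpM2l//.
  have := row_entry_le (orthopoint 2^-1 v a) (orthopoint 2^-1 v b) j.
  rewrite !orthopointE -sumrB -/n.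
  have -> : \sum_(i < k.+1) al i * (j < i)%N%:R = 2 * \sum_(i < k.+1)
      (a (v i) * (if (j < i)%N then 2^-1 else 0) - b (v i) * (if (j < i)%N then 2^-1 else 0)).
    rewrite big_distrr; apply: eq_bigr => i _; rewrite /al inord_val.
    by case: ifP => _ /=; field.
  by rewrite normrM ger0_norm// ler_pM2l.
rewrite -big_distrl /= mulrA; have := cdist_variation x; have n0 : 0 <= n by exact: normr_ge0.
move=> H; rewrite -[leRHS]mul1r ler_wpM2r//.
by have := ler_wpM2r (ler0n R 2) H; rewrite mulVf.
Qed.

(** A vertex of [v j.+1] outside [v j] has [cdist] equal to 1 for [v i] with [i <= j] and to 1/2 for
    later [i]. *)
Lemma orthopoint_entry (j : 'I_k) : exists x,
  phi a x = 1 - orthopoint 2^-1 v a ord0 j /\ phi b x = 1 - orthopoint 2^-1 v b ord0 j.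
Proof.
have jk : (j < k.+1)%N by rewrite ltnS ltnW.
have j1k : (j.+1 < k.+1)%N by rewrite ltnS ltn_ord.
have [x [x1 x0]] := rc_ltP (v_lt (i := Ordinal jk) (j := Ordinal j1k) (ltnSn j)).
suff vx c : [set p | bary c p != 0] `<=` range v -> phi c x = 1 - orthopoint 2^-1 v c ord0 j.
  by exists x; rewrite !vx.
move=> cv; rewrite phiE orthopointE (expect_chain _ v_lt cv).
rewrite -[X in X - _](sum_chain1 v_lt cv) -sumrB; apply: eq_bigr => i _.
rewrite -[X in X - _]mulr1 -mulrBr; congr (_ * _).
case: ltnP => ji.
  have [u vu] := clique_inhab (v (Ordinal jk)).
  have /rc_leP j1i : (v (Ordinal j1k) <= v i)%O by exact: v_le.
  have /rc_leP j0i : (v (Ordinal jk) <= v i)%O by apply: v_le; exact: ltnW.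
  rewrite (cdist_inside (j1i _ x1) (j0i _ vu)); first by lra.
  by move=> ux; rewrite -ux in x0.
rewrite subr0; have ij1 : (v i <= v (Ordinal j1k))%O by apply: v_le; exact: leqW.
apply: cdist_outside ij1 x1 _.
by have /rc_leP ij0 : (v i <= v (Ordinal jk))%O by [exact: v_le]; move=> /ij0.
Qed.

Lemma simplex_isometry :
  `|orthopoint 2^-1 v a - orthopoint 2^-1 v b| = mdist (phi a) (phi b).
Proof.
apply/eqP; rewrite eq_le; apply/andP; split; last first.
  by apply: hull_dist_le => // x; exact: orthopoint_dist_le.
set w := _ - _; have [->|] := eqVneq `|w| 0; first exact: mdist_ge0.
move=> /mx_norm_neq0[[i j] /= ij]; rewrite {1}/Num.norm /= ij [i]ord1 !mxE.
have [x [ax bx]] := orthopoint_entry j.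
apply: le_trans (hull_dist_ge (phi a) (phi b) x); rewrite ax bx.
set oa := orthopoint _ _ a _ _; set ob := orthopoint _ _ b _ _.
by have -> : 1 - oa - (1 - ob) = - (oa - ob) by [ring]; rewrite normrN.
Qed.

(** The orthoscheme coordinates determine the tail sums [t n], and consecutive tail sums differ by
    one barycentric coordinate. *)
Lemma simplex_inj : phi a = phi b -> a = b.
Proof.
move=> ab; pose t n := \sum_(i < k.+1 | (n <= i)%N) (a (v i) - b (v i)).
have t0 n : t n = 0.
  case: n => [|n].
    by rewrite /t sumrB (sum_chain1 v_lt av) (sum_chain1 v_lt bv) subrr.
  have [nk|kn] := ltnP n k; last first.
    by rewrite /t big1// => i ni; have := leq_trans (leq_trans ni (ltn_ord i)) kn; lia.
  have [x [ax bx]] := orthopoint_entry (Ordinal nk).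
  have : orthopoint 2^-1 v a ord0 (Ordinal nk) - orthopoint 2^-1 v b ord0 (Ordinal nk) = 0.
    by have : phi a x = phi b x by [rewrite ab]; rewrite ax bx; lra.
  rewrite !orthopointE -sumrB => H.
  apply: etrans (etrans (congr1 ( *%R 2) H) (mulr0 2)).
  rewrite big_distrr [LHS]big_mkcond /=; apply: eq_bigr => i _.
  by case: ifP => _; field.
apply: realization_eq => p.
have [ap|ap] := eqVneq (a p) 0; last first.
  have [i _ <-] := av ap; apply/eqP; rewrite -subr_eq0.
  have := t0 i; rewrite /t (bigD1 i)//= => /eqP.
  rewrite (eq_bigl (fun j : 'I_k.+1 => (i < j)%N)); last first.
    by move=> j; rewrite [in RHS]ltn_neqAle andbC eq_sym.
  by rewrite -/(t i.+1) t0 addr0.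
have [bp|bp] := eqVneq (b p) 0; first by rewrite ap bp.
have [i _ <-] := bv bp; apply/eqP; rewrite -subr_eq0.
have := t0 i; rewrite /t (bigD1 i)//= => /eqP.
rewrite (eq_bigl (fun j : 'I_k.+1 => (i < j)%N)); last first.
  by move=> j; rewrite [in RHS]ltn_neqAle andbC eq_sym.
by rewrite -/(t i.+1) t0 addr0.
Qed.

End simplex.

(** * Recovering the simplex from nearby hull functions; injectivity *)

Definition joint_chain a b := forall p q,
  (a p != 0) || (b p != 0) -> (a q != 0) || (b q != 0) -> (p >=< q)%O.

Lemma joint_chainP a b : joint_chain a b ->
  exists k (v : 'I_k.+1 -> round_clique X),
  [/\ forall i j : 'I_k.+1, (i < j)%N -> (v i < v j)%O,
      [set p | a p != 0] `<=` range v & [set p | b p != 0] `<=` range v].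
Proof.
move=> ab; have [||k [v [v_lt vs]]] := @chain_simplex _ (round_clique X) (supp a ++ supp b).
- by case: (supp a) (supp_neq0 a).
- by move=> p q; rewrite !mem_cat !mem_supp; exact: ab.
exists k, v; split => // p /= pn; apply: vs; rewrite /= mem_cat !mem_supp pn ?orbT//.
Qed.

Lemma joint_chain_simplex_dist a b : joint_chain a b ->
  simplex_dist 2^-1 a b (mdist (phi a) (phi b)).
Proof.
move=> /joint_chainP[k [v [v_lt av bv]]]; exists k, v; split => //.
by rewrite simplex_isometry.
Qed.

Lemma joint_chain_inj a b : joint_chain a b -> phi a = phi b -> a = b.
Proof. by move=> /joint_chainP[k [v [v_lt av bv]]]; move=> ab; exact: (@simplex_inj _ v v_lt a b av bv ab). Qed.

(** Let [s] be the weight of the members above [p]. Comparing [cdist q] with [dmax p] for [q] above,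
    equal to and below [p] confines [phi a x] between [dmax p x - 1 + (s + a p) / 2] and
    [dmax p x + s / 2]. Shifting by [s / 2 + a p / 4] leaves a margin [a p / 4] at both ends, so
    rounding up tolerates the error [a p / 8]. *)
Lemma recover_clique a p : a p != 0 -> exists t : R,
  forall (g : X -> R), (forall x, `|g x - phi a x| <= a p / 8) ->
    forall x, Num.ceil (g x - t) = (dmax p x)%:Z.
Proof.
move=> ap; have ap0 : 0 < a p by rewrite lt_neqAle eq_sym ap bary_ge0.
set s := expect a (fun q => (p < q)%O%:R); exists (2^-1 * s + a p / 4) => g gx x.
have comp q : a q != 0 -> (p >=< q)%O by exact: bary_chain.
have up : phi a x <= (dmax p x)%:R + 2^-1 * s.
  rewrite phiE -(expect_cst a (dmax p x)%:R) -expectZ -expectD; apply: expect_le => q /comp pq.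
  rewrite /cdist natrD; have [lt|nlt] := boolP (p < q)%O; rewrite /=.
    have := dmin_anti x (ltW lt); have := dmin_le_dmax p x; have := dmax_le_dminS q x.
    by rewrite -!(ler_nat R) -natr1; lra.
  have qp : (q <= p)%O by move: nlt; rewrite lt_neqAle; case/orP: pq => // ->; rewrite andbT negbK => /eqP ->.
  have := dmax_mono x qp; have := dmin_le_dmax q x; rewrite -!(ler_nat R); lra.
have lo : (dmax p x)%:R - 1 + 2^-1 * (s + a p) <= phi a x.
  rewrite phiE -(expect_cst a ((dmax p x)%:R - 1)) -(expect_eq1 a p) -expectD -expectZ -expectD.
  apply: expect_le => q /comp pq; rewrite /cdist natrD.
  have [le|nle] := boolP (p <= q)%O.
    have -> : (p < q)%O%:R + (q == p)%:R = 1 :> R.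
      by move: le; rewrite le_eqVlt eq_sym; have [->|] := eqVneq q p; rewrite ?ltxx ?add0r//= => _ ->; rewrite addr0.
    have := dmax_mono x le; have := dmax_le_dminS q x; rewrite -!(ler_nat R) -natr1; lra.
  have qp : (q <= p)%O by case/orP: pq => // le; rewrite le in nle.
  have -> /= : (p < q)%O = false by apply/negP => /ltW lt; rewrite lt in nle.
  have -> /= : (q == p) = false by apply/negP => /eqP e; rewrite e lexx in nle.
  have := dmin_anti x qp; have := dmax_le_dminS p x; have := dmin_le_dmax q x.
  by rewrite -!(ler_nat R) -natr1; lra.
apply/eqP; rewrite ceil_eq rmorphB /= -pmulrn; have := gx x; rewrite ler_norml; lra.
Qed.

(** If [s <= t], the rounded values give [dmax q <= dmax p], and [q] lies in [p] by [round_dmax]. *)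
Lemma ceil_comparable (g : X -> R) p q (s t : R) :
  (forall x, Num.ceil (g x - s) = (dmax p x)%:Z) ->
  (forall x, Num.ceil (g x - t) = (dmax q x)%:Z) -> (p >=< q)%O.
Proof.
wlog st : p q s t / s <= t => [H ps qt|ps qt].
  by have [st|/ltW ts] := leP s t; [exact: H ps qt|rewrite comparable_sym; exact: H qt ps].
apply/orP; right; apply/rc_leP => v qv; apply: round_dmax => x.
apply: leq_trans (dmax_ge x qv) _.
have : Num.ceil (g x - t) <= Num.ceil (g x - s) by apply: le_ceil; rewrite lerD2l lerN2.
by rewrite ps qt.
Qed.

(** Close to [phi a], the single function [phi b] recovers by rounding both the cliques of [a] and
    those of [b], so all are comparable. *)
Lemma joint_chain_near a : exists2 e : R, 0 < e & forall b,
  mdist (phi a) (phi b) < e -> joint_chain a b.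
Proof.
exists (\big[Num.min/1]_(p <- supp a) (a p / 8)).
  rewrite big_seq; apply: lt_bigmin => // p; rewrite mem_supp => ap.
  by rewrite divr_gt0// lt_neqAle eq_sym ap bary_ge0.
move=> b ab; have rec p : (a p != 0) || (b p != 0) -> exists t : R,
    forall x, Num.ceil (phi b x - t) = (dmax p x)%:Z.
  case/orP => [ap|bp].
    have [t tE] := recover_clique ap; exists t; apply: tE => x.
    rewrite distrC; apply: le_trans (hull_dist_ge (phi a) (phi b) x) _.
    apply: le_trans (ltW ab) _.
    by apply: (@ge_bigmin_seq _ _ _ (supp a) 1 p xpredT (fun p => a p / 8)); rewrite ?mem_supp.
  have [t tE] := recover_clique bp; exists t; apply: tE => x.
  by rewrite subrr normr0 divr_ge0// bary_ge0.
by move=> p q /rec[s sE] /rec[t tE]; exact: ceil_comparable sE tE.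
Qed.

Lemma phi_inj : injective phi.
Proof.
move=> a b ab; have [e e0 H] := joint_chain_near a.
by apply: joint_chain_inj => //; apply: H; rewrite ab mdistxx.
Qed.

End phi.

(** * Surjectivity *)

Lemma finite_pos_lower_bound (R : realType) (W : set R) : finite_set W ->
  exists2 e : R, 0 < e & forall w, W w -> 0 < w -> e <= w.
Proof.
move=> /finite_seqP[s ->]; elim: s => [|a s [e e0 IH]]; first by exists 1.
have [a0|a0] := ltP 0 a; last first.
  exists e => // w /=; rewrite inE => /orP[/eqP -> a1|]; last exact: IH.
  by have := lt_le_trans a1 a0; rewrite ltxx.
exists (Num.min a e); first by rewrite lt_min a0.
move=> w /=; rewrite inE ge_min => /orP[/eqP -> _|ws w0]; first by rewrite lexx.
by rewrite IH ?orbT.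
Qed.

(** The distances of [f x + f y] to the integers take finitely many values. A slack below the least
    positive one makes the sum integral, and a slack below 1 then makes it equal to [mdist x y]. *)
Lemma hull_exact (R : realType) (M : metricType R) (f : injective_hull M) :
  (forall x y : M, exists n : nat, mdist x y = n%:R) ->
  finite_set (range (zdist \o f)) -> forall x, exists y, f x + f y = mdist x y.
Proof.
move=> mdist_nat fin x.
have : finite_set (range (fun y => zdist (f x + f y))).
  (* Modulo 1, [f y] is plus or minus its distance to the integers. *)
  apply: (sub_finite_set (B := (fun e => zdist (f x + e)) @` range (zdist \o f) `|`
                               (fun e => zdist (f x - e)) @` range (zdist \o f))).
    move=> _ [y _ <-]; have [n nE] := zdist_ex (f y).
    have [le|/ltW ge] := leP n%:~R (f y).
      left; exists (zdist (f y)); first by exists y.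
      rewrite nE ger0_norm ?subr_ge0// -[RHS]zdistN -[RHS](zdist_reflect (- n)).
      by congr zdist; rewrite rmorphN /=; ring.
    right; exists (zdist (f y)); first by exists y.
    rewrite nE ler0_norm ?subr_le0// -[RHS]zdistN -[RHS](zdist_reflect (- n)).
    by congr zdist; rewrite rmorphN /=; ring.
  by rewrite finite_setU; split; exact: finite_image.
move=> /finite_pos_lower_bound[e e0 He].
have e1 : 0 < Num.min e 1 / 2 by rewrite divr_gt0// lt_min e0 ltr01.
have [y] := hull_near f x e1; have := hull_ge f x y; have [n nE] := mdist_nat x y.
rewrite nE => ge near; exists y; rewrite nE.
have [me m1] : Num.min e 1 <= e /\ Num.min e 1 <= 1 by rewrite !ge_min !lexx orbT.
have m0 : 0 < Num.min e 1 by rewrite lt_min e0 ltr01.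
have := He (zdist (f x + f y)); have := zdist_le (f x + f y) n.
rewrite -pmulrn ger0_norm ?subr_ge0// => zle /(_ (ex_intro2 _ _ y I erefl)) zlt.
have [/zlt|z0] := ltP 0 (zdist (f x + f y)); first by lra.
have /zdist_eq0[k kE] : zdist (f x + f y) = 0 by apply/eqP; rewrite eq_le z0 zdist_ge0.
move: ge near; rewrite kE pmulrn ler_int => nk near.
have : (k - n%:Z)%:~R < 1%:~R :> R by rewrite rmorphB /=; lra.
rewrite ltr_int => kn; have -> : k = n%:Z by clear -nk kn; lia.
by [].
Qed.

(** * Rounding at a threshold *)

Section round_at.
Context {R : realType}.
Implicit Types (s t u : R).

(* Rounds [u] to the nearest integer if that is within [t], and to the nearest
   half-integer otherwise. *)
Definition round_at t u : R := ((Num.floor (u + t))%:~R - (Num.floor (t - u))%:~R) / 2.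

Lemma round_at_mono t : {homo round_at t : u v / u <= v}.
Proof.
move=> u v uv; rewrite /round_at ler_pM2r// lerB// ler_int; apply: le_floor.
  by rewrite lerD2r.
by rewrite lerD2l lerN2.
Qed.

Lemma round_at_reflect t (n : nat) u : round_at t (n%:R - u) = n%:R - round_at t u.
Proof.
rewrite /round_at pmulrn.
have -> : n%:~R - u + t = n%:~R + (t - u) by ring.
have -> : t - (n%:~R - u) = (- n%:Z)%:~R + (u + t) by rewrite rmorphN /=; ring.
have fD (m : int) (v : R) : Num.floor (m%:~R + v) = m + Num.floor v.
  by rewrite floorDzr ?intr_int// intrKfloor.
by rewrite !fD !rmorphD /= rmorphN /=; field.
Qed.

(** [n] is a nearest integer and [eta] the side of it on which [u] lies; rounding stays at [n] or
    moves by 1/2 towards that side. *)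
Lemma round_atE u : exists (n : int) (eta : R), [/\ eta = 1 \/ eta = -1,
  u = n%:~R + eta * zdist u & forall t, 0 <= t -> t < 2^-1 ->
    round_at t u = n%:~R + eta / 2 * (t < zdist u)%R%:R].
Proof.
have [n nE] := zdist_ex u; have half := zdist_le_half u; have e0 := zdist_ge0 u.
have fl (x : R) (m : int) : m%:~R <= x -> x < m%:~R + 1 -> Num.floor x = m.
  by move=> mx xm; apply: floor_def; rewrite mx rmorphD.
set e := zdist u in nE half e0 *.
have [le|/ltW ge] := leP n%:~R u.
  have uE : u = n%:~R + e by rewrite nE ger0_norm ?subr_ge0//; ring.
  exists n, 1; split; [by left|by rewrite mul1r|move=> t t0 t2].
  rewrite /round_at (fl (u + t) n); [|lra|lra].
  have [te|et] /= := ltP t e.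
    by rewrite (fl (t - u) (- n - 1)); rewrite ?rmorphB ?rmorphN /=; lra.
  by rewrite (fl (t - u) (- n)); rewrite ?rmorphN /=; lra.
have uE : u = n%:~R - e by rewrite nE ler0_norm ?subr_le0//; ring.
exists n, (-1); split; [by right|by rewrite mulN1r|move=> t t0 t2].
rewrite /round_at (fl (t - u) (- n)); [|rewrite rmorphN /=; lra|rewrite rmorphN /=; lra].
have [te|et] /= := ltP t e.
  by rewrite (fl (u + t) (n - 1)); rewrite ?rmorphB ?rmorphN /=; lra.
by rewrite (fl (u + t) n); rewrite ?rmorphN /=; lra.
Qed.

(** As [e] is an entry, the gaps that start below [e] fill exactly the interval from the first entry
    to [e]. *)
Lemma layer_cake (s : seq R) e : sorted <%R s -> e \in s ->
  \sum_(i < (size s).-1) (s`_i.+1 - s`_i) * (s`_i < e)%R%:R = e - s`_0.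
Proof.
move=> ss /(nthP 0)[j js <-]; have sK := prednK (leq_ltn_trans (leq0n _) js).
have mono i i' : (i < size s)%N -> (i' < size s)%N -> (s`_i < s`_i') = (i < i')%N.
  by move=> *; rewrite (lt_sorted_ltn_nth 0 ss).
have mono' i i' : (i < size s)%N -> (i' < size s)%N -> (s`_i <= s`_i') = (i <= i')%N.
  by move=> *; rewrite (lt_sorted_leq_nth 0 ss).
rewrite -(big_mkord xpredT (fun i => (s`_i.+1 - s`_i) * (s`_i < s`_j)%R%:R)).
rewrite (eq_big_nat _ _ (F2 := fun i => Num.min s`_i.+1 s`_j - Num.min s`_i s`_j)); last first.
  move=> i /andP[_ ik]; have i1 : (i.+1 < size s)%N by rewrite -sK ltnS.
  rewrite mono ?(ltnW i1)//; case: ltnP => ij; rewrite ?mulr1 ?mulr0.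
    by rewrite !min_l// mono'// ltnW// ltnW.
  by rewrite !min_r ?subrr// mono'// ltnW.
rewrite telescope_sumr//; congr (_ - _).
  by rewrite min_r// mono'//; [rewrite -ltnS sK|rewrite ltn_predL (leq_ltn_trans _ js)].
by rewrite min_l// mono'// (leq_ltn_trans _ js).
Qed.

End round_at.

Section surjective.
Context {R : realType} {X : connected_graph}.
Hypothesis X_helly : helly X.
Implicit Types f : injective_hull (graph_space R X).

Lemma graph_mdist_nat (x y : graph_space R X) : exists n : nat, mdist x y = n%:R.
Proof. by exists (@gdist X x y). Qed.

(** Finiteness provides tight pairs, so the rounded function is in the hull; being half-integral, it
    comes from a clique. *)
Lemma round_hull f t : finite_set (range (zdist \o f)) ->
  exists p, forall x, cdist R p x = round_at t (f x).
Proof.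
move=> fin; have ex := hull_exact graph_mdist_nat fin.
have [F FE] := hull_comp_exact graph_mdist_nat (@round_at_mono R t) (round_at_reflect t) ex.
have [x|p pE] := half_integral_hull X_helly (f := F); last first.
  by exists p => x; rewrite -pE FE.
have F0 : 0 <= F x by have := hull_ge F x x; rewrite mdistxx; lra.
move: F0; rewrite FE /= /round_at -rmorphB /=; case: (_ - _)%R => n; first by exists n.
by rewrite NegzE rmorphN /= pmulr_lge0// oppr_ge0 -pmulrn leNgt ltr0n.
Qed.

(** The roundings at the thresholds are averaged with twice the gaps as weights; by [layer_cake],
    the values of [round_atE] average to [n + eta * zdist (f x)], which is [f x]. *)
Lemma hull_mixture f : finite_set (range (zdist \o f)) ->
  exists a : realization R (round_clique X), forall x, f x = expect a (fun p => cdist R p x).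
Proof.
move=> fin; have /finite_seqP[z zE] := fin.
(* With 0 and 1/2 included the gaps add up to 1/2, hence the weights to 1. *)
set s : seq R := sort <=%R (undup (0 :: 2^-1 :: z)).
have ms e : (e \in s) = [|| e == 0, e == 2^-1 | e \in z] by rewrite mem_sort mem_undup !inE.
have s_half e : e \in s -> 0 <= e <= 2^-1.
  rewrite ms => /or3P[/eqP ->|/eqP ->|ez]; [lra|lra|].
  have : [set` z] e := ez.
  by rewrite -zE => -[x _ <-]; rewrite /= zdist_ge0 zdist_le_half.
have ss : sorted <%R s by rewrite sort_lt_sorted undup_uniq.
have s0 : 0 \in s by rewrite ms eqxx.
have s2 : 2^-1 \in s by rewrite ms eqxx orbT.
have sz : (0 < size s)%N by case: (s) s0.
have sK := prednK sz.
have s_0 : s`_0 = 0.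
  have [j js jE] := nthP 0 s0; have := s_half _ (mem_nth 0 sz).
  have : s`_0 <= s`_j by rewrite (lt_sorted_leq_nth 0 ss).
  by rewrite jE; lra.
have s_lt i : (i < (size s).-1)%N -> 0 <= s`_i < 2^-1.
  move=> ik; have i1 : (i.+1 < size s)%N by rewrite -sK ltnS.
  have := s_half _ (mem_nth 0 i1); have := s_half _ (mem_nth 0 (ltnW i1)).
  have : s`_i < s`_i.+1 by rewrite (lt_sorted_ltn_nth 0 ss)// inE ltnW.
  by lra.
have /choice[t tE] (i : 'I_(size s).-1) := round_hull s`_i fin.
pose w (i : 'I_(size s).-1) := 2 * (s`_i.+1 - s`_i).
have w0 i : 0 <= w i.
  have i1 : (i.+1 < size s)%N by rewrite (leq_ltn_trans (ltn_ord i))// ltn_predL.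
  by rewrite mulr_ge0// subr_ge0 ltW// (lt_sorted_ltn_nth 0 ss)// inE ltnW.
have isz (i : 'I_(size s).-1) : (i < size s)%N by exact: leq_trans (ltn_ord i) (leq_pred _).
(* [dmax] is the rounded value of [f x] rounded up to an integer, and raising the threshold can only
   replace [n + 1/2] or [n - 1/2] by [n], which does not increase it. *)
have tle (i j : 'I_(size s).-1) : (i <= j)%N -> (t j <= t i)%O.
  move=> ij; apply/rc_leP => v jv; apply: round_dmax => x.
  apply: leq_trans (dmax_ge x jv) _.
  have [n [eta [eta1 _ rE]]] := round_atE (f x).
  have := tE i x; have := tE j x.
  have /andP[i0 i2] := s_lt i (ltn_ord i); have /andP[j0 j2] := s_lt j (ltn_ord j).
  rewrite !rE// /cdist.
  have : (s`_j < zdist (f x)) ==> (s`_i < zdist (f x)).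
    by apply/implyP; apply: le_lt_trans; rewrite (lt_sorted_leq_nth 0 ss (isz i) (isz j)).
  have := dmin_le_dmax (t i) x; have := dmax_le_dminS (t i) x.
  have := dmin_le_dmax (t j) x; have := dmax_le_dminS (t j) x.
  set A := (dmin (t i) x + dmax (t i) x)%N; set B := (dmin (t j) x + dmax (t j) x)%N.
  have nat_eq (a b : int) : a%:~R = b%:~R :> R -> a = b by exact: intr_inj.
  case: (s`_j < _); case: (s`_i < _) => //= h1 h2 h3 h4 _ eB eA.
  - suff : (A%:Z = B%:Z)%R by rewrite /A /B; lia.
    by apply: nat_eq; rewrite -!pmulrn; lra.
  - have hB : B%:Z = (2 * n)%R by apply: nat_eq; rewrite -pmulrn intrM; lra.
    case: eta1 => e1; rewrite e1 in eA.
      have hA : A%:Z = (2 * n + 1)%R.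
        by apply: nat_eq; rewrite -pmulrn [RHS]intrD intrM; lra.
      by move: hA hB; rewrite /A /B; lia.
    have hA : A%:Z = (2 * n - 1)%R.
      by apply: nat_eq; rewrite -pmulrn [RHS]intrB intrM; lra.
    by move: hA hB; rewrite /A /B; lia.
  - suff : (A%:Z = B%:Z)%R by rewrite /A /B; lia.
    by apply: nat_eq; rewrite -!pmulrn; lra.
have tc i j : (t i >=< t j)%O.
  by rewrite /Order.comparable; case: (leqP i j) => [/tle ->|/ltnW/tle ->]; rewrite ?orbT.
have sum1 : \sum_(i < (size s).-1) (s`_i.+1 - s`_i) = 2^-1.
  have lc := layer_cake ss s2; rewrite s_0 subr0 in lc.
  rewrite -[RHS]lc; apply: eq_bigr => i _.
  by have /andP[_ ->] := s_lt i (ltn_ord i); rewrite mulr1.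
have [|a aE] := realization_mixture w0 tc.
  by rewrite -big_distrr /= sum1 divff.
exists a => x; rewrite aE; have [n [eta [_ uE rE]]] := round_atE (f x).
have fs : zdist (f x) \in s.
  by rewrite ms; have : [set` z] (zdist (f x)) by [rewrite -zE; exists x]; move=> /= ->; rewrite !orbT.
have lc := layer_cake ss fs; rewrite s_0 subr0 in lc.
transitivity (\sum_(i < (size s).-1) (2 * n%:~R * (s`_i.+1 - s`_i) +
    eta * ((s`_i.+1 - s`_i) * (s`_i < zdist (f x))%R%:R))).
  rewrite big_split /= -!big_distrr /= sum1 lc {1}uE; congr (_ + _); lra.
apply: eq_bigr => i _; have /andP[i0 i2] := s_lt i (ltn_ord i).
by rewrite tE rE// /w; field.
Qed.

End surjective.

(** * Strings and geodesics *)

Section strings.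
Context {R : realType} {X : connected_graph}.
Implicit Types (a b c : realization R (round_clique X)).
Variable phi : realization R (round_clique X) -> injective_hull (graph_space R X).
Hypothesis phiE : forall a x, phi a x = expect a (fun p => cdist R p x).

Lemma joint_chainC a b : joint_chain a b -> joint_chain b a.
Proof. by move=> ab p q; rewrite orbC => ap; rewrite orbC; exact: ab. Qed.

Lemma simplex_dist_mdist a b r : simplex_dist 2^-1 a b r -> r = mdist (phi a) (phi b).
Proof.
by move=> [k [v [v_lt av bv ->]]]; exact: (simplex_isometry phiE v_lt av bv).
Qed.

Lemma string_lengths0 (l : R) a : string_lengths l a a 0.
Proof. by exists 0%N, (fun=> a), (fun=> 0); split => //; rewrite big_ord0. Qed.

Lemma string_lengths_rcons (l : R) a b c s r :
  string_lengths l a b s -> simplex_dist l b c r -> string_lengths l a c (s + r).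
Proof.
move=> [n [ch [rs [ch0 chn chS ->]]]] bc.
exists n.+1, (fun i => if (i <= n)%N then ch i else c), (fun i => if (i < n)%N then rs i else r).
split => [//||i|]; first by rewrite ltnn.
  move=> /=; rewrite ltnS => /[dup] ile; rewrite {1}leq_eqVlt => /orP[/eqP ->|ilt]; last first.
    by rewrite ile ilt; exact: chS.
  by rewrite leqnn ltnn chn.
rewrite big_ord_recr /= ltnn; congr (_ + _); apply: eq_bigr => i _.
by rewrite ltn_ord.
Qed.

Lemma string_lengths_ge a b s : string_lengths 2^-1 a b s -> mdist (phi a) (phi b) <= s.
Proof.
move=> [n [ch [rs [<- <- chS ->]]]]; elim: n chS => [|n IH] chS.
  by rewrite mdistxx big_ord0.
rewrite big_ord_recr /=; apply: le_trans (metric_triangle _ (phi (ch n)) _) _.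
rewrite (simplex_dist_mdist (chS n (ltnSn n))) lerD2r; apply: IH => i ilt.
by apply: chS; exact: ltnW.
Qed.

Hypothesis phi_surj : forall f, exists a, phi a = f.

(** Continuous induction along a geodesic of the hull lifted through [phi]: the set [S] of times
    reached by short enough strings contains its supremum and extends beyond it as long as this is
    below 1, because close points share a simplex. *)
Lemma string_lengths_geodesic a b :
  exists2 s, string_lengths 2^-1 a b s & s <= mdist (phi a) (phi b).
Proof.
have [g [g0 g1 glip]] := hull_geodesic (phi a) (phi b).
have /choice[c cE] t : exists e, phi e = g t by exact: phi_surj.
have inj := phi_inj phiE.
have c0 : c 0 = a by apply: inj; rewrite cE.
have c1 : c 1 = b by apply: inj; rewrite cE.
set L := mdist (phi a) (phi b) in glip *; have L0 : 0 <= L by exact: mdist_ge0.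
pose S := [set t : R | 0 <= t <= 1 /\
  exists2 s, string_lengths 2^-1 a (c t) s & s <= t * L].
have S0 : S 0.
  split; first by rewrite lexx ler01.
  by exists 0; rewrite ?mul0r// c0; exact: string_lengths0.
have Ssup : has_sup S by split; [exists 0|exists 1 => t [/andP[]]].
pose T := sup S.
have T01 : 0 <= T <= 1.
  apply/andP; split; first by apply: ub_le_sup => //; case: Ssup.
  by apply: ge_sup; [exists 0|move=> t [/andP[]]].
have [e e0 near] := joint_chain_near phiE (c T).
(* Times less than [h] apart have images less than [e] apart; [L] may be 0. *)
pose h := e / (L + 1); have h0 : 0 < h by rewrite divr_gt0// ltr_wpDl.
have close t : 0 <= t <= 1 -> `|T - t| < h -> joint_chain (c T) (c t).
  move=> t01 tT; apply: near; rewrite !cE; apply: le_lt_trans (glip _ _ T01 t01) _.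
  have : e = h * (L + 1) by rewrite /h divfK// gt_eqF// ltr_wpDl.
  by have := normr_ge0 (T - t); clearbody h; nra.
have step t u : S t -> 0 <= u <= 1 -> t <= u -> joint_chain (c t) (c u) -> S u.
  move=> [t01 [s st sL]] u01 tu tuc; split => //.
  exists (s + mdist (phi (c t)) (phi (c u))).
    apply: string_lengths_rcons st _; exact: joint_chain_simplex_dist.
  have := glip _ _ t01 u01; rewrite -!cE ler0_norm ?subr_le0//; lra.
have ST : S T.
  have [t St tT] := sup_adherent h0 Ssup; have tT' : t <= T by apply: ub_le_sup => //; case: Ssup.
  apply: (step t) => //; apply: joint_chainC; apply: close; first by have [] := St.
  by rewrite ger0_norm ?subr_ge0// /T; lra.
have T1 : T = 1.
  apply/eqP; rewrite eq_le; case/andP: (T01) => T0 ->; rewrite leNgt /=; apply/negP => T1.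
  pose u := Num.min 1 (T + h / 2).
  have Tu : T < u by rewrite lt_min T1 ltrDl divr_gt0.
  have u1 : u <= 1 by rewrite ge_min lexx.
  have uh : u <= T + h / 2 by rewrite ge_min lexx orbT.
  have u01 : 0 <= u <= 1 by rewrite u1 (le_trans T0 (ltW Tu)).
  have Su : S u.
    apply: (step T) => //; first exact: ltW.
    by apply: close => //; rewrite ltr0_norm ?subr_lt0//; lra.
  have : u <= T by apply: ub_le_sup => //; case: Ssup.
  by rewrite leNgt Tu.
by case: ST => _ [s]; rewrite T1 c1 mul1r => ? ?; exists s.
Qed.

Lemma orthoscheme_distE a b : orthoscheme_dist 2^-1 a b = (mdist (phi a) (phi b))%:E.
Proof.
apply/eqP; rewrite eq_le; apply/andP; split.
  have [s sab sle] := string_lengths_geodesic a b.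
  by apply: ge_ereal_inf; exists s%:E; [exists s|rewrite lee_fin].
by apply: le_ereal_inf_tmp => _ [s /string_lengths_ge sge <-]; rewrite lee_fin.
Qed.

End strings.

Theorem theorem4p1 (R : realType) (X : connected_graph)
  (X_helly : helly X)
  (X_dim : finite_combinatorial_dim (graph_space R X)) :
  exists phi : realization R (round_clique X) ->
               injective_hull (graph_space R X),
    let isometric psi := forall a b : realization R (round_clique X),
      orthoscheme_dist 2^-1 a b = (mdist (psi a) (psi b))%:E in
    let extends_X psi := forall x : X,
      psi (realization_vertex R (rc_set1 x)) = hull_point (x : graph_space R X) in
    [/\ bijective phi,
        isometric phi,
        extends_X phi,
        (forall (a : realization R (round_clique X)) (x : graph_space R X),
          phi a x = \sum_(p \in [set: round_clique X])
                      a p * phi (realization_vertex R p) x) &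
        forall psi : realization R (round_clique X) ->
                     injective_hull (graph_space R X),
          isometric psi -> extends_X psi -> psi =1 phi].
Proof.
have /choice[phi phiE] := fun a => cdist_ex (R := R) a X_helly.
have [n dim] := X_dim.
have phi_surj f : exists a, phi a = f.
  have [a aE] := hull_mixture X_helly (hull_finite_zdist graph_mdist_nat f dim).
  by exists a; apply: hull_eq => x; rewrite phiE aE.
have iso := orthoscheme_distE phiE phi_surj.
have ext x : phi (realization_vertex R (rc_set1 x)) = hull_point (x : graph_space R X).
  apply: hull_eq => y; rewrite phiE expect_vertex /cdist dmin_set1 dmax_set1 /= mdist_graph.
  by rewrite gdistC natrD; lra.
exists phi => isometric extends_X; split=> //.
- have /choice[g gE] := phi_surj; exists g => // a.
  by apply: (phi_inj phiE); rewrite gE.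
- move=> a x; rewrite phiE; apply: eq_fsbigr => p _.
  by rewrite phiE expect_vertex.
move=> psi psi_iso psi_ext a; apply: hull_eq => x.
(* The values of a hull function are its distances to the points of [X], and these are the same for
   [psi a] and [phi a]. *)
rewrite -[LHS]mdist_hull_point -[RHS]mdist_hull_point; apply: EFin_inj.
by rewrite -[in LHS]psi_ext -psi_iso iso ext.
Qed.
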